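(* Let $1 \le p < t < r < \infty$ or $1 \le p \le t < r = \infty$. Let $W:\mathbb{R}^n \to M_d(\mathbb{C})$ be a matrix weight. A subset $\mathcal{F} \subset M_p^{t,r}(W)$ is totally bounded if the following conditions are valid: (i) $\mathcal{F}$ is bounded, that is, $\sup_{\vec f\in\mathcal{F}} \|\vec f\|_{M_p^{t,r}(W)} < \infty$; (ii) $\mathcal{F}$ uniformly vanishes at infinity, that is, $$\lim_{R\to\infty}\ \sup_{\vec f\in\mathcal{F}} \| \vec f \chi_{B^c(0,R)} \|_{M_p^{t,r}(W)} = 0;$$ (iii) $\mathcal{F}$ is equicontinuous by means of the dyadic average operator, that is (the averages $E_{d,a}\vec f$ being well defined for $\vec f\in\mathcal{F}$, i.e. each $\vec f\in\mathcal{F}$ being locally integrable), $$\lim_{a\to-\infty,\ a\in\mathbb{Z}}\ \sup_{\vec f\in\mathcal{F}} \| \vec f - E_{d,a}\vec f \|_{M_p^{t,r}(W)} = 0 .$$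
   Context: $n,d\in\mathbb{N}$; $M_d(\mathbb{C})$ is the set of $d\times d$ complex matrices, $\|A\|=\sup_{|\vec z|=1}|A\vec z|$ is the operator norm with respect to the Euclidean norm $|\cdot|$ on $\mathbb{C}^d$. A matrix weight is a function $W:\mathbb{R}^n\to M_d(\mathbb{C})$ such that $W(x)$ is nonnegative definite for every $x$, $W(x)$ is invertible for almost every $x$, and the entries of $W$ are locally integrable. Powers $W^\alpha(x)$ are defined (for a.e. $x$) by diagonalization: if $W(x)=U\,\mathrm{diag}(\lambda_i)U^*$ with $U$ unitary, then $W^\alpha(x)=U\,\mathrm{diag}(\lambda_i^\alpha)U^*$. $L^p_{\mathrm{loc}}(W)$ is the set of measurable $\vec f:\mathbb{R}^n\to\mathbb{C}^d$ with $\int_K |W^{1/p}(x)\vec f(x)|^p\,dx<\infty$ for every compact $K$. For $j\in\mathbb{Z}$, $k\in\mathbb{Z}^n$, $Q_{j,k}=\prod_{i=1}^n[2^{-j}k_i,2^{-j}(k_i+1))$ are the dyadic cubes, and $\mathcal{D}_j=\{Q_{j,k}:k\in\mathbb{Z}^n\}$ is the set of dyadic cubes of side length $2^{-j}$. For a cube $Q$, $W(Q):=\int_Q\|W(y)\|\,dy$. For $0<p<t<r<\infty$ or $0<p\le t<r=\infty$, the matrix weighted Bourgain-Morrey space $M_p^{t,r}(W)$ is the set of all $\vec f\in L^p_{\mathrm{loc}}(W)$ such that $$\|\vec f\|_{M_p^{t,r}(W)}:=\left\|\left\{W(Q_{j,k})^{1/t-1/p}\left(\int_{Q_{j,k}}|W^{1/p}(y)\vec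 f(y)|^p\,dy\right)^{1/p}\right\}_{j\in\mathbb{Z},k\in\mathbb{Z}^n}\right\|_{\ell^r}<\infty$$ (the quantity being interpreted as $+\infty$ when not finite). Functions equal a.e. are identified. The dyadic average operator is, for $a\in\mathbb{Z}$, $$E_{d,a}\vec f(x):=\sum_{Q\in\mathcal{D}_{-a}}\frac{\chi_Q(x)}{|Q|}\int_Q\vec f(y)\,dy$$ (cubes of side length $2^a$; the subscript $d$ in $E_{d,a}$ stands for ''dyadic''). $B(0,R)$ is the open ball of center $0$ and radius $R$, $B^c(0,R)$ its complement, and $\chi_E$ the characteristic function of $E$. A set in a metric space is totally bounded if for each $\epsilon>0$ it has a finite $\epsilon$-net. *)

(* Defs.v *)
From HB Require Import structures.
From mathcomp Require Import all_boot all_order all_algebra.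
From mathcomp Require Import all_classical all_reals all_analysis.
From mathcomp Require Import complex.

Set Implicit Arguments.
Unset Strict Implicit.
Unset Printing Implicit Defensive.

Import Order.TTheory GRing.Theory Num.Theory.
Import numFieldNormedType.Exports.

Local Open Scope classical_set_scope.
Local Open Scope ring_scope.
Local Open Scope complex_scope.
Local Open Scope sesquilinear_scope.

(* Lebesgue measure on R^n: the n-fold product, by recursion on n, of the
   one-dimensional [lebesgue_measure] on [n.-tuple R], then its completion. *)

Section tuple_cons_measure.
Context (R : realType) (n : nat).
Local Notation BR := (measurableTypeR R).
Variable m : {sigma_finite_measure set (n.-tuple BR) -> \bar R}.

Definition tcons (x : BR * n.-tuple BR) : n.+1.-tuple BR :=
  [the n.+1.-tuple BR of x.1 :: x.2].

Lemma measurable_tcons : measurable_fun setT tcons.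
Proof. exact: measurable_cons. Qed.

Definition cons_measure : set (n.+1.-tuple BR) -> \bar R :=
  pushforward (lebesgue_measure \x m)%E tcons.

Let cons_measure0 : cons_measure set0 = 0%E.
Proof. by rewrite /cons_measure /pushforward preimage_set0 measure0. Qed.

Let cons_measure_ge0 A : (0 <= cons_measure A)%E.
Proof. by rewrite /cons_measure /pushforward; exact: measure_ge0. Qed.

Let cons_measure_additive : semi_sigma_additive cons_measure.
Proof.
move=> F mF tF mUF; rewrite /cons_measure /pushforward preimage_bigcup.
have mp A : measurable A -> measurable (tcons @^-1` A).
  by move=> mA; rewrite -[X in measurable X]setTI; exact: measurable_tcons.
apply: measure_semi_sigma_additive.
- by move=> k; exact: mp.
- apply/trivIsetP => /= i j _ _ ij; rewrite -preimage_setI.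
  by move/trivIsetP : tF => /(_ _ _ _ _ ij) ->//; rewrite preimage_set0.
- by rewrite -preimage_bigcup; exact: mp.
Qed.

HB.instance Definition _ := isMeasure.Build _ _ _ cons_measure
  cons_measure0 cons_measure_ge0 cons_measure_additive.

Lemma cons_measure_sigma_finite : sigma_finite setT cons_measure.
Proof.
have /sigma_finiteP[F [TF ndF Foo]] := sigma_finiteT (@lebesgue_measure R).
have /sigma_finiteP[G [TG ndG Goo]] := sigma_finiteT m.
pose S k := F k `*` G k.
have ST : setT = \bigcup_k S k.
  rewrite -setXTT TF TG predeqE => -[x y]; split.
    move=> [/= [a _ Fax] [b _ Gby]]; exists (maxn a b) => //; split.
    - by move: x Fax; exact/subsetPset/ndF/leq_maxl.
    - by move: y Gby; exact/subsetPset/ndG/leq_maxr.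
  by move=> [a _ []/= ? ?]; split; exists a.
have Sf k : measurable (S k) /\ ((lebesgue_measure \x m)%E (S k) < +oo)%E.
  have [? ?] := Foo k; have [? ?] := Goo k; split; first exact: measurableX.
  by rewrite product_measure1E// lte_mul_pinfty// ge0_fin_numE.
pose g (x : n.+1.-tuple BR) : BR * n.-tuple BR := (thead x, [tuple of behead x]).
have gK : cancel tcons g.
  by case=> a t; congr pair => //=; exact/val_inj.
have mg : measurable_fun setT g.
  apply/measurable_fun_pairP; split; first exact: measurable_tnth.
  exact: measurable_behead.
exists (fun k => g @^-1` S k); first by rewrite -preimage_bigcup -ST.
move=> k; split.
  by rewrite -[X in measurable X]setTI; apply: mg => //; case: (Sf k).
rewrite /cons_measure /pushforward -comp_preimage.
rewrite (_ : _ @^-1` _ = S k); first by case: (Sf k).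
by apply/funext => x /=; rewrite /preimage /= gK.
Qed.

HB.instance Definition _ := Measure_isSigmaFinite.Build _ _ _ cons_measure
  cons_measure_sigma_finite.

End tuple_cons_measure.

Section tuple_nil_measure.
Context (R : realType).

Definition nil_measure : set (0.-tuple (measurableTypeR R)) -> \bar R :=
  dirac [tuple].

HB.instance Definition _ := Measure.on nil_measure.

Lemma nil_measure_sigma_finite : sigma_finite setT nil_measure.
Proof.
exists (fun _ => setT); first by rewrite bigcup_const.
by move=> _; split => //; rewrite /nil_measure /= diracE mem_set// ltry.
Qed.

HB.instance Definition _ := Measure_isSigmaFinite.Build _ _ _ nil_measure
  nil_measure_sigma_finite.

End tuple_nil_measure.

Fixpoint borel_lebesgue (R : realType) (n : nat) :
    {sigma_finite_measure set (n.-tuple (measurableTypeR R)) -> \bar R} :=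
  match n with
  | 0%N => [the {sigma_finite_measure set _ -> \bar R} of @nil_measure R]
  | k.+1 => [the {sigma_finite_measure set _ -> \bar R} of
              cons_measure (borel_lebesgue R k)]
  end.

(* R^n with the sigma-algebra of Lebesgue measurable sets. *)
Definition Rn (R : realType) (n : nat) : Type :=
  caratheodory_type (mu_ext (borel_lebesgue R n)).

HB.instance Definition _ R n := Measurable.copy (Rn R n)
  (caratheodory_type (mu_ext (borel_lebesgue R n))).

Definition lebesgue (R : realType) (n : nat) : set (Rn R n) -> \bar R :=
  @completed_measure_extension _ _ _ (borel_lebesgue R n).

HB.instance Definition _ R n := Measure.on (@lebesgue R n).

Lemma lebesgue_sigma_finite R n : sigma_finite setT (@lebesgue R n).
Proof. exact/completed_measure_extension_sigma_finite/sigma_finiteT. Qed.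

HB.instance Definition _ R n := Measure_isSigmaFinite.Build _ _ _ (@lebesgue R n)
  (@lebesgue_sigma_finite R n).

Definition Rcoord R n (x : Rn R n) (i : 'I_n) : R := @tnth n R x i.

Lemma lebesgue_box (R : realType) n (A : 'I_n -> set R) :
  (forall i, measurable (A i)) ->
  measurable [set x : Rn R n | forall i, A i (Rcoord x i)] /\
  lebesgue [set x : Rn R n | forall i, A i (Rcoord x i)] =
    (\prod_(i < n) lebesgue_measure (A i))%E.
Proof.
move=> mA.
have mB : forall k (B : 'I_k -> set (measurableTypeR R)), (forall i, measurable (B i)) ->
  measurable [set x : k.-tuple (measurableTypeR R) | forall i, B i (tnth x i)].
  move=> k B Bm.
  rewrite (_ : mkset _ = \bigcap_(i in [set: 'I_k]) ((@tnth k (measurableTypeR R))^~ i @^-1` B i)).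
    apply: fin_bigcap_measurable => // i _.
    by rewrite -[X in measurable X]setTI; exact: measurable_tnth.
  by apply/seteqP; split => [x h i _|x h i]; [exact: h|exact: (h i I)].
split.
  exact: (@caratheodory_measurable_mu_ext _ R _ (borel_lebesgue R n) _ (mB n A mA)).
rewrite /lebesgue /completed_measure_extension /=.
rewrite (@measurable_mu_extE _ R _ (borel_lebesgue R n) _ (mB n A mA)).
elim: n A mA => [|n IH] A mA.
  by rewrite big_ord0 /= /nil_measure /dirac indicE (_ : _ \in _)//; apply/mem_set => -[].
rewrite big_ord_recl /= /cons_measure /pushforward.
rewrite (_ : _ @^-1` _ = A ord0 `*`
   [set x : n.-tuple (measurableTypeR R) | forall i, A (lift ord0 i) (tnth x i)]).
  transitivity (lebesgue_measure (A ord0) * borel_lebesgue R n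
      [set x | forall i, A (lift ord0 i) (tnth x i)])%E.
    apply: product_measure1E; first exact: mA.
    exact: (mB n (fun i => A (lift ord0 i)) (fun i => mA _)).
  by congr (_ * _)%E; exact: IH.
apply/seteqP; split => [[a x] h|[a x] [h0 h] i] /=.
  split; first exact: (h ord0).
  by move=> i; have := h (lift ord0 i); rewrite /Rcoord /tcons /= tnthS.
by case: (unliftP ord0 i) => [j ->|->] //; rewrite tnthS; exact: h.
Qed.

Section euclidean.
Variable R : realType.

(* [n.-tuple R] carries no topology in the library; that of row vectors is the
   usual topology of R^n. *)
Definition compactR n (K : set (Rn R n)) : Prop :=
  compact [set (\row_i Rcoord x i : 'rV[R]_n) | x in K].

Definition eucl_ball n (rho : R) : set (Rn R n) :=
  [set x | Num.sqrt (\sum_i Rcoord x i ^+ 2) < rho].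

Definition cabs (z : R[i]) : R := ComplexField.Normc.normc z.

Definition vnorm d (z : 'cV[R[i]]_d) : R :=
  Num.sqrt (\sum_i cabs (z i 0) ^+ 2).

Definition opnorm d (A : 'M[R[i]]_d) : R :=
  sup [set vnorm (A *m z) | z in [set z | vnorm z = 1]].

(* In the partial order of R[i], [0 <= w] says that w is real and
   nonnegative. *)
Definition nonneg_definite d (A : 'M[R[i]]_d) : Prop :=
  forall z : 'cV[R[i]]_d, 0 <= (z ^t* *m A *m z) 0 0.

(* [spectralmx A] is U^* for a unitary U with A = U diag(lambda) U^*; see
   [mxpowE] for the independence of the diagonalization. *)
Definition mxpow d (A : 'M[R[i]]_d) (alpha : R) : 'M[R[i]]_d :=
  (spectralmx A) ^t* *m
  diag_mx (map_mx (fun l => (complex.Re l `^ alpha)%:C) (spectral_diag A)) *m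
  spectralmx A.

Lemma mxpowE d (U : 'M[R[i]]_d) (l : 'rV[R]_d) (alpha : R) :
  U \is unitarymx ->
  mxpow (U *m diag_mx (map_mx (fun x => x%:C) l) *m U ^t*) alpha =
  U *m diag_mx (map_mx (fun x => (x `^ alpha)%:C) l) *m U ^t*.
Proof.
move=> uU; set A := U *m _ *m _.
have UU : U ^t* *m U = 1%:M by have /unitarymxP/mulmx1C := uU.
have hA : A ^t* = A.
  rewrite /A !trmx_mul !map_mxM trmxCK mulmxA; congr (_ *m _ *m _).
  rewrite tr_diag_mx map_diag_mx; congr diag_mx.
  by apply/rowP => j; rewrite !mxE; apply/eqP; rewrite eq_complex /= oppr0 !eqxx.
have /orthomx_spectralP : A \is normalmx by apply/normalmxP; rewrite hA.
rewrite invmx_unitary ?spectral_unitarymx// /mxpow.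
have /unitarymxP BB := spectral_unitarymx A.
move: (spectralmx A) (spectral_diag A) BB => B S BB AE.
have BB' : B ^t* *m B = 1%:M by exact: mulmx1C.
have MS : diag_mx S *m (B *m U) = (B *m U) *m diag_mx (map_mx (fun x => x%:C) l).
  transitivity (B *m A *m U).
    by rewrite AE !mulmxA BB mul1mx.
  by rewrite /A !mulmxA -[_ *m U ^t* *m U]mulmxA UU mulmx1.
set f := map_mx _ S; set g := map_mx _ l.
have fg : diag_mx f *m (B *m U) = (B *m U) *m diag_mx g.
  apply/matrixP => i j; rewrite mul_diag_mx mul_mx_diag !mxE.
  move/matrixP : MS => /(_ i j); rewrite mul_diag_mx mul_mx_diag !mxE.
  set b := \sum_k _; have [->|b0] := eqVneq b 0; first by rewrite !mulr0 !mul0r.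
  by rewrite mulrC => /(mulfI b0) ->; rewrite mulrC.
transitivity (B ^t* *m (diag_mx f *m (B *m U)) *m U ^t*).
  by have /unitarymxP UU' := uU; rewrite !mulmxA -[_ *m U *m _]mulmxA UU' mulmx1.
by rewrite fg !mulmxA BB' mul1mx.
Qed.

Variable n : nat.
Local Notation mu := (@lebesgue R n).

Definition cmeasurable (g : Rn R n -> R[i]) : Prop :=
  measurable_fun setT (fun x => complex.Re (g x)) /\
  measurable_fun setT (fun x => complex.Im (g x)).

Definition loc_integrable (g : Rn R n -> R[i]) : Prop :=
  cmeasurable g /\
  forall K, compactR K -> (\int[mu]_(x in K) (cabs (g x))%:E < +oo)%E.

Definition vmeasurable d (f : Rn R n -> 'cV[R[i]]_d) : Prop :=
  forall i, cmeasurable (fun x => f x i 0).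

Definition vloc_integrable d (f : Rn R n -> 'cV[R[i]]_d) : Prop :=
  forall i, loc_integrable (fun x => f x i 0).

Definition vintegral d (A : set (Rn R n)) (f : Rn R n -> 'cV[R[i]]_d) :
    'cV[R[i]]_d :=
  \col_i ((\int[mu]_(x in A) complex.Re (f x i 0))%R +i*
          (\int[mu]_(x in A) complex.Im (f x i 0))%R).

Definition matrix_weight d (W : Rn R n -> 'M[R[i]]_d) : Prop :=
  [/\ forall x, nonneg_definite (W x),
      {ae mu, forall x, W x \in unitmx} &
      forall i j, loc_integrable (fun x => W x i j)].

(* Q_{j,k}, of side length 2^{-j}. *)
Definition dyadic_cube (j : int) (k : n.-tuple int) : set (Rn R n) :=
  [set x | forall i, 2 ^ (- j) * (tnth k i)%:~R <= Rcoord x i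
                     < 2 ^ (- j) * ((tnth k i)%:~R + 1)].

(* E_{d,a}: for each x at most one term of the sum is nonzero. *)
Definition dyadic_avg d (a : int) (f : Rn R n -> 'cV[R[i]]_d) (x : Rn R n) :
    'cV[R[i]]_d :=
  \sum_(k \in [set: n.-tuple int])
    (\1_(dyadic_cube (- a) k) x / fine (mu (dyadic_cube (- a) k)))%:C *:
      vintegral (dyadic_cube (- a) k) f.

Definition restrict_off_ball d (rho : R) (f : Rn R n -> 'cV[R[i]]_d) (x : Rn R n) :
    'cV[R[i]]_d :=
  (\1_(~` @eucl_ball n rho) x)%:C *: f x.

Section bourgain_morrey.
Variables (d : nat) (W : Rn R n -> 'M[R[i]]_d) (p t : R) (r : \bar R).
Implicit Type f : Rn R n -> 'cV[R[i]]_d.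

Definition weight_measure (Q : set (Rn R n)) : \bar R :=
  \int[mu]_(y in Q) (opnorm (W y))%:E.

Definition weighted_integral f (A : set (Rn R n)) : \bar R :=
  \int[mu]_(y in A) (vnorm (mxpow (W y) p^-1 *m f y) `^ p)%:E.

Definition Lp_loc f : Prop :=
  vmeasurable f /\
  forall K, compactR K -> (weighted_integral f K < +oo)%E.

Definition lr_norm (I : choiceType) (u : I -> \bar R) : \bar R :=
  match r with
  | r'%:E => (\esum_(i in setT) (u i `^ r')) `^ r'^-1
  | _ => ereal_sup (range u)
  end%E.

Definition BM_norm f : \bar R :=
  lr_norm (fun jk : int * n.-tuple int =>
    let Q := dyadic_cube jk.1 jk.2 in
    weight_measure Q `^ (t^-1 - p^-1) * weighted_integral f Q `^ p^-1)%E.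

Definition BM_space : set (Rn R n -> 'cV[R[i]]_d) :=
  [set f | Lp_loc f /\ (BM_norm f < +oo)%E].

(* supremum in [0, +oo], so that the supremum over the empty family is 0 *)
Definition BM_sup (F : set (Rn R n -> 'cV[R[i]]_d)) : \bar R :=
  ereal_sup (0%E |` [set BM_norm f | f in F]).

Definition BM_totally_bounded (F : set (Rn R n -> 'cV[R[i]]_d)) : Prop :=
  forall e : R, 0 < e ->
  exists N : set (Rn R n -> 'cV[R[i]]_d),
    [/\ finite_set N, N `<=` BM_space &
        forall f, F f -> exists2 g, N g & (BM_norm (f \- g)%R < e%:E)%E].

End bourgain_morrey.
End euclidean.

(* Main.v *)
Require Import Defs.
From mathcomp Require Import all_boot all_order all_algebra.
From mathcomp Require Import all_classical all_reals all_analysis.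
From mathcomp Require Import finmap measurable_realfun complex ring lra zify.

(** Write q for the norm and E f for the dyadic average of f at a fine scale.
    If U is a finite union of dyadic cubes of that scale covering the ball of
    radius rho, then 1_U E f differs from f by f - E f on U and by f off U, and
    the points off U lie outside the ball.  Since q is monotone under pointwise
    truncation, equicontinuity and vanishing at infinity make this error
    uniformly small over the family.  The functions 1_U E f are step functions on
    finitely many cubes, so the family is, up to a small error, bounded in a
    finite-dimensional space, and bounded sets there should be totally bounded.

    Three points need care.

    The function q may be infinite on some step functions (for instance when W
    is integrable and r is finite), so it is only an extended seminorm on the
    finite-dimensional space, and equivalence of norms is not available.
    [spanned_net] finds finite nets of bounded sets for any such q by removing
    one generator at a time.  The net points it yields may fail to belong to
    the Bourgain-Morrey space; [approximation_net] replaces them by members of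
    the family.

    In place of Minkowski's inequality the argument uses the weaker bound
    q (f + g) <= K (q f + q g) for some constant K: each layer of the norm (the
    Euclidean norm, the p-th power integral, the l^r sum) contributes a factor,
    coming from [vnormD] and [poweRD_le].

    Additivity of the integral in the inner layer requires |W^(1/p) f| to be
    measurable, although W^(1/p) is defined by a pointwise choice of a
    diagonalization.  The functions phi for which phi(W) is measurable form an
    algebra closed under pointwise limits and under inverses of nonvanishing
    functions; it contains the identity, hence the indicators of rays as limits
    of rational functions, hence those of Borel sets, hence all nonnegative
    Borel functions ([calc_measurable_fun]). *)

Set Implicit Arguments.
Unset Strict Implicit.
Unset Printing Implicit Defensive.

Import Order.TTheory GRing.Theory Num.Theory.
Import numFieldNormedType.Exports.

Local Open Scope classical_set_scope.
Local Open Scope ring_scope.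

(** * Finite nets in discs of the complex plane *)

Section cabs_theory.
Context {R : realType}.
Implicit Types z w : R[i].

Lemma cabs_ge0 z : 0 <= cabs z.
Proof. by case: z => a b; exact: sqrtr_ge0. Qed.

Lemma cabs0 : cabs (0 : R[i]) = 0.
Proof. exact: ComplexField.Normc.normc0. Qed.

Lemma cabsN z : cabs (- z) = cabs z.
Proof. by case: z => a b /=; rewrite /cabs /= !sqrrN. Qed.

Lemma cabsM z w : cabs (z * w) = cabs z * cabs w.
Proof. exact: ComplexField.Normc.normcM. Qed.

Lemma cabs_sqr z : cabs z ^+ 2 = complex.Re z ^+ 2 + complex.Im z ^+ 2.
Proof. by case: z => a b /=; rewrite sqr_sqrtr// addr_ge0// sqr_ge0. Qed.

Lemma cabs_eq0 z : (cabs z == 0) = (z == 0).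
Proof.
apply/eqP/eqP => [/ComplexField.Normc.eq0_normc//|->].
exact: cabs0.
Qed.

Lemma cabsV z : cabs z^-1 = (cabs z)^-1.
Proof.
have [->|z0] := eqVneq z 0.
  by rewrite invr0 cabs0 invr0.
have cz : cabs z != 0 by rewrite cabs_eq0.
apply: (mulfI cz); rewrite -cabsM !mulfV//.
exact: ComplexField.Normc.normc1.
Qed.

Lemma ler_Re_cabs z : `|complex.Re z| <= cabs z.
Proof.
rewrite -(@ler_pXn2r _ 2)// ?nnegrE ?cabs_ge0// real_normK ?num_real// cabs_sqr.
by rewrite lerDl sqr_ge0.
Qed.

Lemma ler_Im_cabs z : `|complex.Im z| <= cabs z.
Proof.
rewrite -(@ler_pXn2r _ 2)// ?nnegrE ?cabs_ge0// real_normK ?num_real// cabs_sqr.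
by rewrite lerDr sqr_ge0.
Qed.

Lemma cabs_le z : cabs z <= `|complex.Re z| + `|complex.Im z|.
Proof.
rewrite -(@ler_pXn2r _ 2)// ?nnegrE ?cabs_ge0 ?addr_ge0// cabs_sqr.
rewrite -[complex.Re z ^+ 2]real_normK ?num_real//.
rewrite -[complex.Im z ^+ 2]real_normK ?num_real//.
rewrite sqrrD lerD2r lerDl.
by rewrite mulrn_wge0// mulr_ge0.
Qed.

Lemma real_interval_net (L e : R) : 0 < e ->
  exists s : seq R, forall x, `|x| <= L -> exists2 y, y \in s & `|x - y| <= e.
Proof.
move=> e0; pose m := (Num.truncn (2 * L / e)).+1.
exists [seq - L + e * k%:R | k <- iota 0 m] => x; rewrite ler_norml => /andP[Lx xL].
have xL0 : 0 <= (x + L) / e by apply: divr_ge0; [lra|exact: ltW].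
have /andP[k1 k2] := truncn_itv xL0.
exists (- L + e * (Num.truncn ((x + L) / e))%:R).
  apply/mapP; exists (Num.truncn ((x + L) / e)) => //.
  rewrite mem_iota add0n ltnS leq0n /=; apply: le_truncn.
  by rewrite ler_pM2r ?invr_gt0// mulr2n mulrDl !mul1r lerD2r.
move: k1 k2; rewrite ler_pdivlMr// ltr_pdivrMr// => k1 k2.
rewrite ler_norml; apply/andP; split.
  by rewrite -subr_ge0; move: k1; rewrite -subr_ge0 => k1; lra.
move: k2; rewrite -natr1 mulrDl mul1r => k2; lra.
Qed.

Lemma complex_disc_net (L e : R) : 0 < e ->
  exists s : seq R[i], forall z, cabs z <= L ->
    exists2 w, w \in s & cabs (z - w) <= e.
Proof.
move=> e0; have [s sP] := @real_interval_net L (e / 2) (divr_gt0 e0 (ltr0Sn _ 1)).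
exists [seq (a +i* b)%C | a <- s, b <- s] => z zL.
have [a sa za] := sP _ (le_trans (ler_Re_cabs z) zL).
have [b sb zb] := sP _ (le_trans (ler_Im_cabs z) zL).
exists (a +i* b)%C; first by apply/allpairsP; exists (a, b).
rewrite (le_trans (cabs_le _))//.
by move: za zb; case: z {zL} => u v /= za zb; rewrite [e]splitr lerD.
Qed.

End cabs_theory.

(** * Nets in finite-dimensional quasi-seminormed spaces *)

(** The span is encoded by recursion on the generators because nets are built by
    removing them one at a time; the coefficients need not be unique. *)
Fixpoint spanned (K : pzRingType) (V : lmodType K) (s : seq V) (x : V) : Prop :=
  if s is e :: s' then exists c, spanned s' (x - c *: e) else x = 0.

Lemma spannedDZ (K : comPzRingType) (V : lmodType K) (s : seq V) a x y :
  spanned s x -> spanned s y -> spanned s (x + a *: y).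
Proof.
elim: s x y => [|e s IH] x y /=; first by move=> -> ->; rewrite scaler0 addr0.
move=> [c xs] [c' ys]; exists (c + a * c').
rewrite [X in spanned s X](_ : _ = x - c *: e + a *: (y - c' *: e)); first exact: IH.
by rewrite scalerBr scalerDl scalerA opprD addrACA.
Qed.

Lemma spannedBZ (K : comPzRingType) (V : lmodType K) (s : seq V) a x y :
  spanned s x -> spanned s y -> spanned s (x - a *: y).
Proof. by move=> xs ys; rewrite -scaleNr; exact: spannedDZ. Qed.

Lemma spanned_sum (K : comPzRingType) (V : lmodType K) (I : Type) (s : seq I)
    (h : I -> V) (c : I -> K) : spanned (map h s) (\sum_(i <- s) c i *: h i).
Proof.
elim: s => [|i s IH] /=; first by rewrite big_nil.
by exists (c i); rewrite big_cons addrC addKr.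
Qed.

Section net_in_finite_dimension.
Context {R : realType} (V : lmodType R[i]) (M : set V) (q : V -> \bar R) (K : R).
Hypothesis K0 : 0 < K.
Hypothesis M0 : M 0.
Hypothesis MDZ : forall a x y, M x -> M y -> M (x + a *: y).
Hypothesis qD : forall x y, M x -> M y -> (q (x + y) <= K%:E * (q x + q y))%E.
Hypothesis qZ : forall a x, M x -> (q (a *: x) <= (cabs a)%:E * q x)%E.

Let MZ a x : M x -> M (a *: x).
Proof. by move=> Mx; rewrite -[_ *: _]add0r; exact: MDZ. Qed.

Let MB x y : M x -> M y -> M (x - y).
Proof. by move=> Mx My; rewrite -scaleN1r; exact: MDZ. Qed.

Lemma spanned_sub s x : (forall e, e \in s -> M e) -> spanned s x -> M x.
Proof.
elim: s x => [x _ ->//|e s IH x Ms [c xs]].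
rewrite -[x](subrK (c *: e)); apply: MDZ; last by apply: Ms; rewrite mem_head.
by apply: IH xs => e' es; apply: Ms; rewrite in_cons es orbT.
Qed.

Let qD_le x y (a b : R) : M x -> M y -> (q x <= a%:E)%E -> (q y <= b%:E)%E ->
  (q (x + y) <= (K * (a + b))%:E)%E.
Proof.
move=> Mx My xa yb; apply: (le_trans (qD Mx My)).
rewrite EFinM EFinD; apply: lee_wpmul2l; first by rewrite lee_fin ltW.
exact: leeD.
Qed.

Let qZ_le a x (b : R) : M x -> (q x <= b%:E)%E -> (q (a *: x) <= (cabs a * b)%:E)%E.
Proof.
move=> Mx xb; apply: (le_trans (qZ a Mx)).
rewrite EFinM; apply: lee_wpmul2l => //; by rewrite lee_fin cabs_ge0.
Qed.

(** Induction on the generators, v being the first.  If the coefficient of v is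
    unbounded on the set q <= B, then every multiple of v occurring there is,
    modulo the other generators, the multiple of v in some z with q z as small as
    desired, so v can be dropped at a small cost.  If it is bounded, then either
    it is always 0, or v can be replaced by a v' with q v' finite, and a grid of
    coefficients of v' combined with a net for the other generators does.
    Throughout, q may vanish or be infinite on parts of the span. *)
Lemma spanned_net (s : seq V) (B e : R) : (forall x, x \in s -> M x) ->
  0 <= B -> 0 < e ->
  exists2 N : seq V, (forall y, y \in N -> M y) &
    forall x, spanned s x -> (q x <= B%:E)%E ->
      exists2 y, y \in N & (q (x - y) <= e%:E)%E.
Proof.
elim: s B e => [|v s IH] B e Ms B0 e0.
  exists [:: 0] => [y|x]; first by rewrite inE => /eqP ->.
  move=> -> _; exists 0; rewrite ?mem_head// subrr -(scale0r 0).
  apply: (le_trans (qZ _ M0)).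
  by rewrite cabs0 mul0e lee_fin ltW.
have Mv : M v by apply: Ms; rewrite mem_head.
have {}Ms x : x \in s -> M x by move=> xs; apply: Ms; rewrite in_cons xs orbT.
have Mvs c x : spanned s (x - c *: v) -> M x.
  by move=> /(spanned_sub Ms) h; rewrite -[x](subrK (c *: v)); exact: MDZ.
have [e' e'0 Ke'] : exists2 e', 0 < e' & K * (e' + e') = e.
  exists (e / (K + K)); first by rewrite divr_gt0// addr_gt0.
  by rewrite -mulrDl mulrA mulrDr [K * e]mulrC -mulrDr mulfK// gt_eqF// addr_gt0.
have [[L bL]|unb] := pselect (exists L, forall x c, spanned s (x - c *: v) ->
    (q x <= B%:E)%E -> cabs c <= L); last first.
  (* Unbounded coefficient: z := (c / c') x' has the same coefficient of v as x
     and q z <= e', so x - z is spanned by s and can be approximated there. *)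
  have B'0 : 0 <= K * (B + e') by rewrite mulr_ge0 ?addr_ge0// ?ltW.
  have [N MN sN] := IH _ _ Ms B'0 e'0.
  exists N => // x [c xs] xB.
  have [x' [c' [x's x'B cc']]] : exists x' c', [/\ spanned s (x' - c' *: v),
      (q x' <= B%:E)%E & cabs c * B / e' < cabs c'].
    apply: contrapT => h; apply: unb; exists (cabs c * B / e') => x' c' h1 h2.
    by rewrite leNgt; apply/negP => h3; apply: h; exists x', c'.
  have c'0 : 0 < cabs c'.
    by apply: le_lt_trans cc'; rewrite divr_ge0 ?mulr_ge0 ?cabs_ge0// ltW.
  have c'n0 : c' != 0 by rewrite -cabs_eq0 gt_eqF.
  pose z := (c / c') *: x'.
  have Mx := Mvs _ _ xs; have Mx' := Mvs _ _ x's.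
  have Mz : M z by exact: MZ.
  have qz a : cabs a = cabs (c / c') -> (q (a *: x') <= e'%:E)%E.
    move=> ac; apply: (le_trans (qZ_le a Mx' x'B)); rewrite ac lee_fin.
    rewrite cabsM cabsV mulrAC ler_pdivrMr// ltW//.
    by move: cc'; rewrite ltr_pdivrMr// [_ * e']mulrC.
  have sxz : spanned s (x - z).
    rewrite [X in spanned s X](_ : _ = x - c *: v - (c / c') *: (x' - c' *: v)).
      exact: spannedBZ.
    by rewrite scalerBr scalerA divfK// opprB addrA addrNK.
  have [||y yN xzy] := sN (x - z) => //.
    rewrite -scaleNr; apply: qD_le => //; first exact: MZ.
    by apply: qz; rewrite cabsN.
  exists y => //; rewrite -Ke' [x - y](_ : _ = x - z - y + z).
    by apply: qD_le => //; [apply: MB; [exact: MB|exact: MN]|exact: qz].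
  by rewrite addrAC subrK.
have [[x0 [c0 [x0s x0B c00]]]|no] := pselect (exists x0 c0,
    [/\ spanned s (x0 - c0 *: v), (q x0 <= B%:E)%E & c0 != 0]); last first.
  have [N MN sN] := IH _ _ Ms B0 e0.
  exists N => // x [c xs] xB.
  have c0 : c = 0.
    by apply: contrapT => /eqP c0; apply: no; exists x, c.
  by apply: sN => //; move: xs; rewrite c0 scale0r subr0.
(* Bounded coefficient: v' is v modulo the span of s, and q v' is finite even if
   q v is not. *)
pose v' := c0^-1 *: x0; pose A := cabs c0^-1 * B.
have A0 : 0 <= A by rewrite mulr_ge0 ?cabs_ge0.
have Mv' : M v' by apply: MZ; exact: Mvs x0s.
have qv' : (q v' <= A%:E)%E by apply: qZ_le => //; exact: Mvs x0s.
have L0 : 0 <= L by apply: le_trans (bL _ _ x0s x0B); exact: cabs_ge0.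
have B'0 : 0 <= K * (B + L * A).
  by apply: mulr_ge0; [exact: ltW|apply: addr_ge0 => //; exact: mulr_ge0].
have [N MN sN] := IH _ _ Ms B'0 e'0.
(* A may be 0, hence the division by A + 1. *)
have A1 : 0 < A + 1 by rewrite ltr_wpDl.
have [s' s'P] := @complex_disc_net R L (e' / (A + 1)) (divr_gt0 e'0 A1).
exists [seq y + a *: v' | y <- N, a <- s'].
  by move=> y /allpairsP[[y' a] /= [yN _ ->]]; apply: MDZ => //; exact: MN.
move=> x [c xs] xB; have cL := bL _ _ xs xB; have Mx := Mvs _ _ xs.
have [a as' ca] := s'P _ cL.
have [||y yN xy] := sN (x - c *: v').
- rewrite [X in spanned s X](_ : _ = x - c *: v - (c / c0) *: (x0 - c0 *: v)).
    exact: spannedBZ.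
  by rewrite /v' scalerBr !scalerA divfK// opprB addrA addrNK.
- rewrite -scaleNr; apply: qD_le => //; first exact: MZ.
  apply: (le_trans (qZ_le _ Mv' qv')); rewrite lee_fin ler_wpM2r//.
  by rewrite cabsN.
exists (y + a *: v'); first by apply/allpairsP; exists (y, a).
rewrite -Ke' [x - _](_ : _ = x - c *: v' - y + (c - a) *: v').
  apply: qD_le => //; last 1 first.
  - apply: (le_trans (qZ_le _ Mv' qv')); rewrite lee_fin.
    rewrite (le_trans (ler_wpM2r A0 ca))// mulrAC ler_pdivrMr//.
    by rewrite ler_wpM2l ?ltW// ltrDl.
  - by apply: MB; [apply: MB => //; exact: MZ|exact: MN].
  - exact: MZ.
by rewrite scalerBl opprD !addrA; congr (_ - _); rewrite [RHS]addrAC subrK.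
Qed.

(** The net is chosen inside F: the points given by [spanned_net] only serve to
    split F into finitely many pieces of small diameter. *)
Lemma approximation_net (F : set V) (B : R) : F `<=` M -> 0 <= B ->
  (forall f, F f -> (q f <= B%:E)%E) ->
  (forall e, 0 < e -> exists2 s : seq V, (forall x, x \in s -> M x) &
    forall f, F f -> exists2 g, spanned s g & (q (f - g) <= e%:E)%E) ->
  forall e, 0 < e -> exists N : set V,
    [/\ finite_set N, N `<=` F &
        forall f, F f -> exists2 h, N h & (q (f - h) < e%:E)%E].
Proof.
move=> FM B0 FB approx e e0.
have qB_le x y (a b : R) : M x -> M y -> (q x <= a%:E)%E -> (q y <= b%:E)%E ->
    (q (x - y) <= (K * (a + b))%:E)%E.
  move=> Mx My xa yb; rewrite -scaleN1r; apply: qD_le xa _ => //; first exact: MZ.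
  apply: (le_trans (qZ _ My)).
  by rewrite cabsN [cabs 1]ComplexField.Normc.normc1 mul1e.
(* An element f of F is within D of some spanned g, and g within D of a net
   point y: r * D bounds the distance from f to y, and C * D that between two
   elements of F that share y. *)
pose r := K * (1 + 1); pose C := K * (r + r).
have C0 : 0 < C.
  by apply: mulr_gt0 => //; apply: addr_gt0; apply: mulr_gt0 => //; exact: addr_gt0.
pose D := e / (C + 1).
have D0 : 0 < D by rewrite divr_gt0// addr_gt0.
have [s Ms sF] := approx D D0.
have B'0 : 0 <= K * (B + D) by apply: mulr_ge0; [exact: ltW|apply: addr_ge0 => //; exact: ltW].
have [N MN sN] := spanned_net Ms B'0 D0.
have FN f : F f -> exists2 y, y \in N & (q (f - y) <= (K * (D + D))%:E)%E.
  move=> Ff; have Mf := FM _ Ff; have [g sg fg] := sF _ Ff.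
  have Mg := spanned_sub Ms sg.
  have gB : (q g <= (K * (B + D))%:E)%E.
    rewrite -[g](subKr f); apply: qB_le => //; first exact: MB.
    exact: FB.
  have [y yN gy] := sN _ sg gB; exists y => //.
  by rewrite -(subrKA g); apply: qD_le => //; apply: MB => //; exact: MN.
(* If no element of F is close to y, then c y is the default value 0, which may
   lie outside F; such y are discarded. *)
pose c y := xget 0 [set f | F f /\ (q (f - y) <= (K * (D + D))%:E)%E].
exists [set c y | y in [set y | y \in N /\ F (c y)]]; split.
- apply: finite_image; apply: (sub_finite_set _ (finite_seq N)).
  by move=> y [].
- by move=> _ [y [_ Fcy] <-].
- move=> f Ff; have [y yN fy] := FN f Ff.
  have [Fc cy] : F (c y) /\ (q (c y - y) <= (K * (D + D))%:E)%E.
    by apply: (@xgetPex _ 0 [set f | F f /\ (q (f - y) <= (K * (D + D))%:E)%E]);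
      exists f.
  exists (c y); first by exists y.
  have My := MN _ yN; have Mf := FM _ Ff; have Mc := FM _ Fc.
  rewrite -(subrKA y f) -[y - c y]opprB.
  apply: (@le_lt_trans _ _ (K * (K * (D + D) + K * (D + D)))%:E).
    by apply: qB_le => //; exact: MB.
  rewrite lte_fin (_ : _ * _ = e * (C / (C + 1))).
    by rewrite -[ltRHS]mulr1 ltr_pM2l// ltr_pdivrMr ?mul1r ?ltrDl// addr_gt0.
  by rewrite /D /C /r; field; rewrite -/r -/C gt_eqF// addr_gt0.
Qed.

End net_in_finite_dimension.

(** * Functional calculus of nonnegative definite matrices *)

Section functional_calculus.
Local Open Scope complex_scope.
Local Open Scope sesquilinear_scope.
Context {R : realType} {d : nat}.
Implicit Types (A : 'M[R[i]]_d) (phi psi : R -> R).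

Lemma spectralmxK A : (spectralmx A)^t* *m spectralmx A = 1%:M.
Proof. by have /unitarymxP/mulmx1C := spectral_unitarymx A. Qed.

Lemma spectralmxKV A : spectralmx A *m (spectralmx A)^t* = 1%:M.
Proof. exact/unitarymxP/spectral_unitarymx. Qed.

(** The columns of U^* are eigenvectors of U^* diag(l) U. *)
Lemma unitary_quadform (U : 'M[R[i]]_d) (l : 'rV[R[i]]_d) k :
  U *m U^t* = 1%:M ->
  ((col k (U^t* ))^t* *m (U^t* *m diag_mx l *m U) *m col k (U^t* )) 0 0 = l 0 k.
Proof.
move=> UU; rewrite colE trmx_mul map_mxM trmxCK !mulmxA.
rewrite -[_ *m U *m U^t*]mulmxA UU mulmx1 -[_ *m U *m U^t*]mulmxA UU mulmx1.
rewrite trmx_delta map_delta_mx -[_ *m delta_mx _ _]mulmxA -rowE -colE !mxE.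
by rewrite eqxx mulr1n.
Qed.

(** Evaluating the form at the eigenvectors of A shows that all eigenvalues of A
    are 0. *)
Lemma normal_quadform0 A : A \is normalmx ->
  (forall z : 'cV[R[i]]_d, (z^t* *m A *m z) 0 0 = 0) -> A = 0.
Proof.
move=> /orthomx_spectralP AE A0; rewrite AE.
suff -> : spectral_diag A = 0.
  by rewrite (_ : diag_mx 0 = 0) ?mulmx0 ?mul0mx//; apply/matrixP => i j;
    rewrite !mxE mul0rn.
apply/rowP => k; rewrite mxE.
rewrite -(unitary_quadform _ _ (spectralmxKV A)).
by rewrite -[X in _ *m (X *m _ *m _) *m _]invmx_unitary ?spectral_unitarymx// -AE.
Qed.

(** The form of the skew-adjoint, hence normal, matrix A - A^* vanishes because
    that of A is real; so A is self-adjoint by [normal_quadform0], without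
    polarization. *)
Lemma nonneg_definite_adj A : nonneg_definite A -> A^t* = A.
Proof.
move=> A0; apply/esym/eqP; rewrite -subr_eq0; apply/eqP.
have BN : (A - A^t*)^t* = - (A - A^t*).
  by rewrite linearB /= map_mxB trmxCK opprB.
apply: normal_quadform0; first by apply/normalmxP; rewrite BN mulmxN mulNmx.
move=> z; rewrite mulmxBr mulmxBl mxE.
have Az := A0 z.
have -> : z^t* *m A^t* *m z = (z^t* *m A *m z)^t*.
  by rewrite !trmx_mul !map_mxM trmxCK mulmxA.
move: (z^t* *m A *m z) Az => m /ger0_real/CrealP m0.
by rewrite !mxE m0 subrr.
Qed.

Lemma nonneg_definite_spectral A : nonneg_definite A ->
  A = (spectralmx A)^t* *m diag_mx (spectral_diag A) *m spectralmx A.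
Proof.
move=> /nonneg_definite_adj hA.
rewrite -invmx_unitary ?spectral_unitarymx//; apply/orthomx_spectralP.
by apply/normalmxP; rewrite hA.
Qed.

Lemma nonneg_definite_eigen A k : nonneg_definite A -> 0 <= spectral_diag A 0 k.
Proof.
move=> A0; rewrite -(unitary_quadform _ _ (spectralmxKV A)).
by rewrite -nonneg_definite_spectral.
Qed.

(** The matrix phi(A) for A nonnegative definite; [mxpow A alpha] is its instance
    for the power function. *)
Definition fcalc A phi : 'M[R[i]]_d :=
  (spectralmx A)^t* *m
  diag_mx (map_mx (fun l => (phi (complex.Re l))%:C) (spectral_diag A)) *m
  spectralmx A.

(** For fixed A the entries depend linearly on the finitely many values of phi at
    the eigenvalues, so they inherit pointwise limits. *)
Lemma fcalcE A phi i j : fcalc A phi i j =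
  \sum_k (phi (complex.Re (spectral_diag A 0 k)))%:C *
    (((spectralmx A)^t* ) i k * spectralmx A k j).
Proof.
rewrite /fcalc mxE; apply: eq_bigr => k _.
by rewrite mul_mx_diag !mxE mulrAC [RHS]mulrC mulrC.
Qed.

Lemma eq_fcalc A phi psi : nonneg_definite A ->
  (forall x, 0 <= x -> phi x = psi x) -> fcalc A phi = fcalc A psi.
Proof.
move=> A0 e; apply/matrixP => i j; rewrite !fcalcE; apply: eq_bigr => k _.
rewrite e//; have := nonneg_definite_eigen k A0.
by case: (spectral_diag A 0 k) => a b; rewrite lecE /= => /andP[].
Qed.

Lemma fcalc_id A : nonneg_definite A -> fcalc A id = A.
Proof.
move=> A0; rewrite /fcalc (_ : map_mx _ _ = spectral_diag A).
  exact/esym/nonneg_definite_spectral.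
apply/rowP => k; rewrite mxE.
have := nonneg_definite_eigen k A0.
by case: (spectral_diag A 0 k) => a b; rewrite lecE /= => /andP[/eqP ->].
Qed.

Lemma fcalcM A phi psi : fcalc A phi *m fcalc A psi = fcalc A (phi \* psi).
Proof.
rewrite /fcalc; set U := spectralmx A.
have diagM (u v : 'rV[R[i]]_d) : U^t* *m diag_mx u *m U *m (U^t* *m diag_mx v *m U) =
    U^t* *m (diag_mx u *m diag_mx v) *m U.
  by rewrite !mulmxA -[_ *m U *m U^t*]mulmxA spectralmxKV mulmx1.
rewrite diagM mulmx_diag; do 3! f_equal.
by apply/rowP => k; rewrite !mxE rmorphM.
Qed.

Lemma fcalcD A phi psi : fcalc A (phi \+ psi) = fcalc A phi + fcalc A psi.
Proof.
apply/matrixP => i j; rewrite [RHS]mxE !fcalcE -big_split; apply: eq_bigr => k _ /=.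
by rewrite rmorphD mulrDl.
Qed.

Lemma fcalc_cst A c : fcalc A (cst c) = c%:C%:M.
Proof.
rewrite /fcalc (_ : map_mx _ _ = const_mx c%:C); last first.
  by apply/rowP => k; rewrite !mxE.
by rewrite diag_const_mx mul_mx_scalar -scalemxAl spectralmxK scalemx1.
Qed.

Lemma fcalcV A phi : (forall x, phi x != 0) ->
  fcalc A phi \in unitmx /\ fcalc A (fun x => (phi x)^-1) = invmx (fcalc A phi).
Proof.
move=> phi0.
have e : fcalc A phi *m fcalc A (fun x => (phi x)^-1) = 1%:M.
  rewrite fcalcM (_ : _ \* _ = cst 1) ?fcalc_cst//.
  by apply/funext => x /=; rewrite mulfV.
have [u _] := mulmx1_unit e; split => //.
by rewrite -[LHS](mulKmx u) e mulmx1.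
Qed.

End functional_calculus.

(** * Measurability of functions of a matrix field *)

Section cmeasurable_theory.
Local Open Scope complex_scope.
Context {R : realType} {n : nat}.
Implicit Types (g h : Rn R n -> R[i]).

Lemma cmeasurable_cst c : cmeasurable (fun _ : Rn R n => c).
Proof. by split; exact: measurable_cst. Qed.

Lemma cmeasurableD g h : cmeasurable g -> cmeasurable h ->
  cmeasurable (fun x => g x + h x).
Proof.
move=> [g1 g2] [h1 h2]; split.
- rewrite (_ : (fun x => _) = (fun x => complex.Re (g x)) \+ (fun x => complex.Re (h x))).
    exact: measurable_funD.
  by apply/funext => x /=; rewrite raddfD.
- rewrite (_ : (fun x => _) = (fun x => complex.Im (g x)) \+ (fun x => complex.Im (h x))).
    exact: measurable_funD.
  by apply/funext => x /=; rewrite raddfD.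
Qed.

Lemma cmeasurableM g h : cmeasurable g -> cmeasurable h ->
  cmeasurable (fun x => g x * h x).
Proof.
move=> [g1 g2] [h1 h2]; split.
- rewrite (_ : (fun x => _) =
    ((fun x => complex.Re (g x)) \* (fun x => complex.Re (h x))) \-
    ((fun x => complex.Im (g x)) \* (fun x => complex.Im (h x)))).
    by apply: measurable_funB; exact: measurable_funM.
  by apply/funext => x /=; case: (g x) (h x) => [a b] [c e].
- rewrite (_ : (fun x => _) =
    ((fun x => complex.Re (g x)) \* (fun x => complex.Im (h x))) \+
    ((fun x => complex.Im (g x)) \* (fun x => complex.Re (h x)))).
    by apply: measurable_funD; exact: measurable_funM.
  by apply/funext => x /=; case: (g x) (h x) => [a b] [c e].
Qed.

Lemma cmeasurable_real (u : Rn R n -> R) : measurable_fun setT u ->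
  cmeasurable (fun x => (u x)%:C).
Proof. by move=> mu; split => //; exact: measurable_cst. Qed.

Lemma cmeasurable_sum (I : Type) (s : seq I) (F : I -> Rn R n -> R[i]) :
  (forall i, cmeasurable (F i)) -> cmeasurable (fun x => \sum_(i <- s) F i x).
Proof.
move=> mF; elim: s => [|i s IH].
  have e x : \sum_(i <- [::]) F i x = 0 by rewrite big_nil.
  by under eq_fun do rewrite e; exact: cmeasurable_cst.
have e x : \sum_(j <- i :: s) F j x = F i x + \sum_(j <- s) F j x by rewrite big_cons.
by under eq_fun do rewrite e; exact: cmeasurableD.
Qed.

Lemma cmeasurable_prod (I : Type) (s : seq I) (F : I -> Rn R n -> R[i]) :
  (forall i, cmeasurable (F i)) -> cmeasurable (fun x => \prod_(i <- s) F i x).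
Proof.
move=> mF; elim: s => [|i s IH].
  have e x : \prod_(i <- [::]) F i x = 1 by rewrite big_nil.
  by under eq_fun do rewrite e; exact: cmeasurable_cst.
have e x : \prod_(j <- i :: s) F j x = F i x * \prod_(j <- s) F j x by rewrite big_cons.
by under eq_fun do rewrite e; exact: cmeasurableM.
Qed.

Lemma measurable_normsq g : cmeasurable g ->
  measurable_fun setT (fun x => cabs (g x) ^+ 2).
Proof.
move=> [g1 g2]; under eq_fun do rewrite cabs_sqr.
by apply: measurable_funD; exact: measurable_funX.
Qed.

(** The inverse of g is its conjugate divided by the square of its modulus, and
    the real inverse of a nonnegative number is a power, which is measurable. *)
Lemma cmeasurableV g : cmeasurable g -> cmeasurable (fun x => (g x)^-1).
Proof.
move=> mg.
have mi : measurable_fun setT (fun x => (cabs (g x) ^+ 2) `^ (-1)).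
  apply: (@measurableT_comp _ _ _ _ _ _ (@powR R ^~ (-1))); last exact: measurable_normsq.
  exact: measurable_powR.
have e x : (g x)^-1 = ((cabs (g x) ^+ 2) `^ (-1))%:C * (complex.Re (g x) -i* complex.Im (g x)).
  rewrite powR_inv1 ?sqr_ge0// cabs_sqr; case: (g x) => a b /=.
  by apply/eqP; rewrite eq_complex /=; apply/andP; split; apply/eqP; simpc; rewrite mulrC ?mulNr.
under eq_fun do rewrite e.
apply: cmeasurableM; first exact: cmeasurable_real.
case: mg => g1 g2; split; first exact: g1.
exact: measurable_funN.
Qed.

Lemma cmeasurable_cvg (F : nat -> Rn R n -> R[i]) g :
  (forall k, cmeasurable (F k)) ->
  (forall x, (fun k => complex.Re (F k x)) @ \oo --> complex.Re (g x)) ->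
  (forall x, (fun k => complex.Im (F k x)) @ \oo --> complex.Im (g x)) ->
  cmeasurable g.
Proof.
move=> mF c1 c2; split.
- apply: (@measurable_fun_cvg _ _ _ setT (fun k x => complex.Re (F k x))).
    by move=> k; case: (mF k).
  by move=> x _; exact: c1.
- apply: (@measurable_fun_cvg _ _ _ setT (fun k x => complex.Im (F k x))).
    by move=> k; case: (mF k).
  by move=> x _; exact: c2.
Qed.

Definition mxmeasurable m k (M : Rn R n -> 'M[R[i]]_(m, k)) : Prop :=
  forall i j, cmeasurable (fun x => M x i j).

Lemma mxmeasurable_mul m k l (M : Rn R n -> 'M[R[i]]_(m, k))
    (N : Rn R n -> 'M[R[i]]_(k, l)) :
  mxmeasurable M -> mxmeasurable N -> mxmeasurable (fun x => M x *m N x).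
Proof.
move=> mM mN i j; under eq_fun do rewrite mxE.
by apply: cmeasurable_sum => a; apply: cmeasurableM; [exact: mM|exact: mN].
Qed.

Lemma mxmeasurable_add m k (M N : Rn R n -> 'M[R[i]]_(m, k)) :
  mxmeasurable M -> mxmeasurable N -> mxmeasurable (fun x => M x + N x).
Proof.
move=> mM mN i j; under eq_fun do rewrite mxE.
exact: cmeasurableD.
Qed.

Lemma cmeasurable_det m (M : Rn R n -> 'M[R[i]]_m) :
  mxmeasurable M -> cmeasurable (fun x => \det (M x)).
Proof.
move=> mM; apply: cmeasurable_sum => s.
apply: cmeasurableM; first exact: cmeasurable_cst.
by apply: cmeasurable_prod => i; exact: mM.
Qed.

(** By Cramer's rule the entries of the inverse are rational in those of M. *)
Lemma mxmeasurable_inv m (M : Rn R n -> 'M[R[i]]_m) :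
  (forall x, M x \in unitmx) -> mxmeasurable M ->
  mxmeasurable (fun x => invmx (M x)).
Proof.
move=> uM mM i j.
have e x : invmx (M x) i j = (\det (M x))^-1 * cofactor (M x) j i.
  by rewrite /invmx uM !mxE.
under eq_fun do rewrite e.
apply: cmeasurableM; first by apply: cmeasurableV; exact: cmeasurable_det.
apply: cmeasurableM; first exact: cmeasurable_cst.
apply: cmeasurable_det => a b.
by under eq_fun do rewrite !mxE; exact: mM.
Qed.

End cmeasurable_theory.

Lemma cvg_sum_seq {R : realType} (I : Type) (s : seq I) (G : nat -> I -> R)
    (g : I -> R) : (forall i, G^~ i @ \oo --> g i) ->
  (fun k => \sum_(i <- s) G k i) @ \oo --> \sum_(i <- s) g i.
Proof.
move=> Gg; elim: s => [|i s IH].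
  have e k : \sum_(i <- [::]) G k i = 0 by rewrite big_nil.
  by under eq_fun do rewrite e; rewrite big_nil; exact: cvg_cst.
have e k : \sum_(j <- i :: s) G k j = G k i + \sum_(j <- s) G k j.
  by rewrite big_cons.
by under eq_fun do rewrite e; rewrite big_cons; apply: cvgD.
Qed.

Section measurable_calculus.
Local Open Scope complex_scope.
Local Open Scope sesquilinear_scope.
Import HBNNSimple.
Context {R : realType} {n d : nat} (W : Rn R n -> 'M[R[i]]_d).
Hypothesis W_ge0 : forall x, nonneg_definite (W x).
Hypothesis mW : mxmeasurable W.
Implicit Types phi psi : R -> R.

Definition calc_measurable phi := mxmeasurable (fun x => fcalc (W x) phi).

(** Only the values on [0, +oo[ matter, the eigenvalues being nonnegative. *)
Lemma calc_measurable_eq phi psi : (forall x, 0 <= x -> phi x = psi x) ->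
  calc_measurable phi -> calc_measurable psi.
Proof.
move=> e mphi i j; under eq_fun do rewrite -(eq_fcalc (W_ge0 _) e).
exact: (mphi i j).
Qed.

Lemma calc_measurable_cst c : calc_measurable (cst c).
Proof.
by move=> i j; under eq_fun do rewrite fcalc_cst; exact: cmeasurable_cst.
Qed.

Lemma calc_measurable_id : calc_measurable id.
Proof. by move=> i j; under eq_fun do rewrite fcalc_id//; exact: mW. Qed.

Lemma calc_measurableD phi psi : calc_measurable phi -> calc_measurable psi ->
  calc_measurable (phi \+ psi).
Proof.
move=> m1 m2 i j; under eq_fun do rewrite fcalcD.
exact: (mxmeasurable_add m1 m2 i j).
Qed.

Lemma calc_measurableM phi psi : calc_measurable phi -> calc_measurable psi ->
  calc_measurable (phi \* psi).
Proof.
move=> m1 m2 i j; under eq_fun do rewrite -fcalcM.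
exact: (mxmeasurable_mul m1 m2 i j).
Qed.

Lemma calc_measurable_affine a b phi : calc_measurable phi ->
  calc_measurable (fun x => a + b * phi x).
Proof.
move=> mphi; apply: (@calc_measurableD (cst a) (cst b \* phi)).
  exact: calc_measurable_cst.
by apply: calc_measurableM; [exact: calc_measurable_cst|exact: mphi].
Qed.

Lemma calc_measurableX phi k : calc_measurable phi ->
  calc_measurable (fun x => phi x ^+ k).
Proof.
move=> m1; elim: k => [|k IH]; first exact: calc_measurable_cst.
under eq_fun do rewrite exprS.
exact: calc_measurableM.
Qed.

Lemma calc_measurableV phi : (forall x, phi x != 0) -> calc_measurable phi ->
  calc_measurable (fun x => (phi x)^-1).
Proof.
move=> phi0 m1 i j; under eq_fun do rewrite (fcalcV _ phi0).2.
by apply: (mxmeasurable_inv _ m1 i j) => x; exact: (fcalcV _ phi0).1.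
Qed.

Lemma fcalc_entry_cvg (A : 'M[R[i]]_d) (F : nat -> R -> R) phi i j : nonneg_definite A ->
  (forall x, 0 <= x -> F^~ x @ \oo --> phi x) ->
  ((fun k => complex.Re (fcalc A (F k) i j : R[i])) @ \oo -->
     complex.Re (fcalc A phi i j : R[i])) /\
  ((fun k => complex.Im (fcalc A (F k) i j : R[i])) @ \oo -->
     complex.Im (fcalc A phi i j : R[i])).
Proof.
move=> A0 cF; pose l (k : 'I_d) := complex.Re (spectral_diag A 0 k).
have l0 k : 0 <= l k.
  rewrite /l; have := nonneg_definite_eigen k A0.
  by case: (spectral_diag A 0 k) => a b; rewrite lecE /= => /andP[].
have ReM (a : R) (z : R[i]) : complex.Re (a%:C * z) = a * complex.Re z.
  by case: z => u v /=; rewrite mul0r subr0.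
have ImM (a : R) (z : R[i]) : complex.Im (a%:C * z) = a * complex.Im z.
  by case: z => u v /=; rewrite mul0r addr0.
pose w k := (spectralmx A)^t* i k * spectralmx A k j.
have cvg_lin (f : R[i] -> R) :
    (forall psi, f (fcalc A psi i j) = \sum_k psi (l k) * f (w k)) ->
    (fun k => f (fcalc A (F k) i j)) @ \oo --> f (fcalc A phi i j).
  move=> fE; under eq_fun do rewrite fE; rewrite fE.
  by apply: cvg_sum_seq => k; apply: cvgMr_tmp; exact: cF.
split; apply: cvg_lin => psi; rewrite fcalcE raddf_sum;
  apply: eq_bigr => k _ ; [exact: ReM|exact: ImM].
Qed.

Lemma calc_measurable_cvg (F : nat -> R -> R) phi :
  (forall k, calc_measurable (F k)) ->
  (forall x, 0 <= x -> F^~ x @ \oo --> phi x) -> calc_measurable phi.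
Proof.
move=> mF cF i j.
apply: (@cmeasurable_cvg _ _ (fun k x => fcalc (W x) (F k) i j)).
- by move=> k; exact: mF.
- by move=> x; exact: (fcalc_entry_cvg i j (W_ge0 x) cF).1.
- by move=> x; exact: (fcalc_entry_cvg i j (W_ge0 x) cF).2.
Qed.

(** The indicator of the union is the limit of 1 - prod_(k < m) (1 - 1_(B k)). *)
Lemma calc_measurable_bigcup (B : nat -> set R) :
  (forall k, calc_measurable \1_(B k)) -> calc_measurable \1_(\bigcup_k B k).
Proof.
move=> mB.
pose F m (x : R) : R := \prod_(k < m) (1 - \1_(B k) x).
apply: (@calc_measurable_cvg (fun m x => 1 - F m x)) => [m|x _].
  apply: (@calc_measurable_eq (fun x => 1 + (-1) * F m x)).
    by move=> x _ /=; rewrite mulN1r.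
  apply: calc_measurable_affine.
  elim: m => [|m IH].
    apply: (@calc_measurable_eq (cst 1)); last exact: calc_measurable_cst.
    by move=> x _; rewrite /F big_ord0.
  apply: (@calc_measurable_eq (F m \* (fun x => 1 + (-1) * \1_(B m) x))).
    by move=> x _ /=; rewrite /F big_ord_recr/= mulN1r.
  apply: calc_measurableM; first exact: IH.
  by apply: calc_measurable_affine; exact: mB.
have [[k _ Bkx]|nB] := pselect ((\bigcup_k B k) x).
  rewrite indicE mem_set; last by exists k.
  apply: (@cvg_near_cst _ _ _ _ _ _ _).
  exists k.+1 => // m /= km; apply/eqP.
  by rewrite /F (bigD1 (Ordinal km))//= indicE mem_set// subrr mul0r subr0.
rewrite indicE memNset//=.
apply: cvg_near_cst; exists 0%N => // m _ /=; rewrite /F big1 ?subrr// => k _.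
by rewrite indicE memNset ?subr0// => Bkx; apply: nB; exists k.
Qed.

(** For b > 0 and x >= 0 the rational functions 1 / (1 + (x / b)^k) converge to
    a function h that equals 1 below b, 1/2 at b and 0 above b, and
    (1 - h) (1 - 2 h) is the indicator of the open ray starting at b.  The ray
    starting at 0 is a countable union of these, and a ray starting below 0
    contains all eigenvalues. *)
Lemma calc_measurable_ray c : calc_measurable \1_`]c, +oo[.
Proof.
have pos_ray (b : R) : 0 < b -> calc_measurable \1_`]b, +oo[.
  move=> b0; pose h (x : R) : R := if x < b then 1 else if x == b then 2^-1 else 0.
  apply: (@calc_measurable_eq ((fun x => 1 + (-1) * h x) \* (fun x => 1 + (-2) * h x))).
    move=> x _ /=; rewrite indicE /h; case: ltgtP => xb.
    - by rewrite memNset/= ?in_itv/= ?andbT ?ltNge ?ltW//; lra.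
    - by rewrite mem_set/= ?in_itv/= ?andbT//; lra.
    - by rewrite memNset/= ?in_itv/= ?andbT ?xb ?ltxx//; lra.
  have mh : calc_measurable h; last first.
    by apply: calc_measurableM; apply: calc_measurable_affine; exact: mh.
  apply: (@calc_measurable_cvg (fun k x => (1 + (`|x| / b) ^+ k)^-1)) => [k|x x0].
    apply: calc_measurableV => [x|].
      by rewrite gt_eqF// ltr_pwDl// exprn_ge0// divr_ge0// ltW.
    apply: (@calc_measurable_eq (fun x => 1 + 1 * (0 + b^-1 * x) ^+ k)).
      by move=> x x0 /=; rewrite ger0_norm// mul1r add0r mulrC.
    apply: calc_measurable_affine; apply: calc_measurableX.
    by apply: calc_measurable_affine; exact: calc_measurable_id.
  rewrite ger0_norm// /h; have xb0 : 0 <= x / b by rewrite divr_ge0// ltW.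
  case: ltgtP => xb.
  - have : (fun k => (x / b) ^+ k) @ \oo --> (0 : R).
      by apply: cvg_expr; rewrite ger0_norm// ltr_pdivrMr// mul1r.
    move=> h1.
    suff : (fun k => (1 + (x / b) ^+ k)^-1) @ \oo --> (1 + 0 : R)^-1.
      by rewrite addr0 invr1.
    apply: cvgV; first by rewrite addr0.
    by apply: cvgD => //; exact: cvg_cst.
  - have x_gt0 : 0 < x by exact: lt_trans xb.
    have zlim : (fun k => (b / x) ^+ k) @ \oo --> (0 : R).
      apply: cvg_expr; rewrite ger0_norm ?ltr_pdivrMr ?mul1r//.
      by rewrite divr_ge0// ltW.
    apply: (@squeeze_cvgr _ _ _ _ (cst 0) (fun k => (b / x) ^+ k)) => //; last exact: cvg_cst.
    apply: nearW => k /=.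
    have xk : 0 < (x / b) ^+ k by rewrite exprn_gt0// divr_gt0.
    rewrite invr_ge0 (addr_ge0 _ (ltW xk))//= -[b / x]invf_div exprVn.
    by rewrite lef_pV2 ?posrE ?addr_gt0// lerDr.
  - rewrite xb divff ?gt_eqF//; under eq_fun do rewrite expr1n; exact: cvg_cst.
have [c0|c0|->] := ltgtP c 0; last 1 first.
- have -> : `]0%R, +oo[%classic = \bigcup_k `](k.+1%:R : R)^-1, +oo[%classic.
    apply/seteqP; split => [x|x [k _]] /=; rewrite !in_itv/= !andbT; last exact: lt_trans.
    move=> x0.
    exists (Num.truncn x^-1) => //=; rewrite in_itv/= andbT.
    rewrite -[ltRHS]invrK ltf_pV2 ?posrE ?invr_gt0//.
    exact: truncnS_gt.
  by apply: calc_measurable_bigcup => k; exact: pos_ray.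
- apply: (@calc_measurable_eq (cst 1)); last exact: calc_measurable_cst.
  by move=> x x0; rewrite indicE mem_set//= in_itv/= andbT (lt_le_trans c0).
- exact: pos_ray.
Qed.

(** The sets whose indicator is admissible form a sigma-algebra containing the
    rays. *)
Lemma calc_measurable_indic (B : set R) : measurable B -> calc_measurable \1_B.
Proof.
have -> : measurable B = (@RGenOInfty.G R).-sigma.-measurable B.
  by rewrite -RGenOInfty.measurableE.
move: B; apply: smallest_sub => [|_ [c ->]]; last exact: calc_measurable_ray.
split.
- apply: (@calc_measurable_eq (cst 0)); last exact: calc_measurable_cst.
  by move=> x _; rewrite indic0.
- move=> B mB; apply: (@calc_measurable_eq (fun x => 1 + (-1) * \1_B x)).
    by move=> x _ /=; rewrite setTD indicC indicE; case: (x \in B) => /=; lra.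
  by apply: calc_measurable_affine; exact: mB.
- by move=> B mB; exact: calc_measurable_bigcup.
Qed.

Lemma calc_measurable_fun phi : (forall x, 0 <= phi x) ->
  measurable_fun setT phi -> calc_measurable phi.
Proof.
move=> phi0 mphi.
have mphiE : measurable_fun setT (EFin \o phi) by exact/measurable_EFinP.
pose F := nnsfun_approx measurableT mphiE.
apply: (@calc_measurable_cvg (fun k x => F k x)) => [k|x _]; last first.
  have F_cvg : EFin \o F^~ x @ \oo --> (phi x)%:E.
    by apply: cvg_nnsfun_approx => // y _; rewrite lee_fin.
  exact: (fine_cvg F_cvg).
pose s := fset_set (F k @` setT).
apply: (@calc_measurable_eq (fun x => \sum_(i < #|` s|) (s`_i * \1_(F k @^-1` [set s`_i]) x))).
  by move=> x _; rewrite [RHS]fimfunEord.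
elim: (index_enum _) => [|i l IH].
  apply: (@calc_measurable_eq (cst 0)); last exact: calc_measurable_cst.
  by move=> x _; rewrite big_nil.
apply: (@calc_measurable_eq ((cst s`_i \* \1_(F k @^-1` [set s`_i])) \+
    (fun x => \sum_(i <- l) (s`_i * \1_(F k @^-1` [set s`_i]) x)))).
  by move=> x _; rewrite big_cons.
apply: calc_measurableD; last exact: IH.
apply: calc_measurableM; first exact: calc_measurable_cst.
by apply: calc_measurable_indic; exact: measurable_sfunP.
Qed.

(** Although the unitary matrices diagonalizing W x are chosen pointwise, without
    any regularity in x, the powers of W are measurable. *)
Lemma mxmeasurable_mxpow alpha : mxmeasurable (fun x => mxpow (W x) alpha).
Proof.
apply: (@calc_measurable_fun (fun x => x `^ alpha)) => [x|]; first exact: powR_ge0.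
exact: measurable_powR.
Qed.

End measurable_calculus.

(** * Quasi-norm inequalities for the inner and outer norms *)

Section lr_norm_theory.
Context {R : realType}.

Lemma le_poweR (s : R) (x y : \bar R) : 0 <= s -> (0 <= x)%E -> (x <= y)%E ->
  (x `^ s <= y `^ s)%E.
Proof.
move=> s0 x0 xy; apply: gt0_ler_poweR => //; rewrite in_itv/= ?leey ?andbT//.
exact: le_trans xy.
Qed.

(** The sum is at most twice the larger term.  This crude bound replaces
    Minkowski's inequality throughout. *)
Lemma poweRD_le (s : R) (x y : \bar R) : 0 <= s -> (0 <= x)%E -> (0 <= y)%E ->
  ((x + y) `^ s <= (2 `^ s)%:E * (x `^ s + y `^ s))%E.
Proof.
move=> s0; wlog xy : x y / (x <= y)%E => [wh x0 y0|x0 y0].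
  have [/wh|/ltW/wh] := leP x y; first exact.
  by rewrite addeC [X in (_ * X)%E]addeC; exact.
apply: (@le_trans _ _ ((2%:E * y) `^ s)%E).
  apply: le_poweR => //; first exact: adde_ge0.
  by rewrite mule_natl mule2n leeD2r.
rewrite poweRM// ?lee_fin//= lee_pmul2l//= ?lte_fin ?powR_gt0//.
by rewrite leeDr// poweR_ge0.
Qed.

Lemma esumZ_le (I : choiceType) (c : R) (u : I -> \bar R) : 0 <= c ->
  (forall i, 0 <= u i)%E ->
  (\esum_(i in setT) (c%:E * u i) <= c%:E * \esum_(i in setT) u i)%E.
Proof.
move=> c0 u0; apply: ge_ereal_sup => _ [X [finX _] <-].
rewrite -ge0_mule_fsumr// lee_wpmul2l ?lee_fin//.
by apply: esum_ge; exists X.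
Qed.

Lemma le_lr_norm (r : \bar R) (I : choiceType) (u v : I -> \bar R) :
  (0 < r)%E -> (forall i, 0 <= u i)%E -> (forall i, u i <= v i)%E ->
  (lr_norm r u <= lr_norm r v)%E.
Proof.
case: r => [r| |]// r0 u0 uv; rewrite /lr_norm; last first.
  apply: ge_ereal_sup => _ [i _ <-]; apply: (le_trans (uv i)).
  by apply: ereal_sup_ubound; exists i.
rewrite lte_fin in r0.
apply: le_poweR; first by rewrite invr_ge0 ltW.
  by apply: esum_ge0 => i _; exact: poweR_ge0.
by apply: le_esum => i _; apply: le_poweR => //; exact: ltW.
Qed.

Lemma lr_normZ (r : \bar R) (I : choiceType) (c : R) (u : I -> \bar R) :
  (0 < r)%E -> 0 <= c -> (forall i, 0 <= u i)%E ->
  (lr_norm r (fun i => c%:E * u i) <= c%:E * lr_norm r u)%E.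
Proof.
case: r => [r| |]// r0 c0 u0; rewrite /lr_norm; last first.
  apply: ge_ereal_sup => _ [i _ <-]; apply: lee_wpmul2l; first by rewrite lee_fin.
  by apply: ereal_sup_ubound; exists i.
rewrite lte_fin in r0.
have s0 : (0 <= \esum_(i in [set: I]) u i `^ r)%E.
  by apply: esum_ge0 => i _; exact: poweR_ge0.
apply: (@le_trans _ _ (((c `^ r)%:E * \esum_(i in [set: I]) u i `^ r) `^ r^-1)%E).
  apply: le_poweR; first by rewrite invr_ge0 ltW.
    by apply: esum_ge0 => i _; exact: poweR_ge0.
  have e i : ((c%:E * u i) `^ r = (c `^ r)%:E * u i `^ r)%E.
    by rewrite poweRM ?lee_fin.
  rewrite (eq_esum (fun i _ => e i)).
  by apply: esumZ_le => [|i]; [exact: powR_ge0|exact: poweR_ge0].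
rewrite poweRM ?lee_fin ?powR_ge0//=.
by rewrite -powRrM mulfV ?gt_eqF// powRr1.
Qed.

Lemma lr_normD (r : \bar R) (I : choiceType) : (0 < r)%E ->
  exists2 C : R, 0 < C & forall u v : I -> \bar R,
    (forall i, 0 <= u i)%E -> (forall i, 0 <= v i)%E ->
    (lr_norm r (fun i => u i + v i) <= C%:E * (lr_norm r u + lr_norm r v))%E.
Proof.
case: r => [r| |]// r0; last first.
  exists 1 => // u v u0 v0; rewrite mul1e /lr_norm.
  apply: ge_ereal_sup => _ [i _ <-].
  by apply: leeD; apply: ereal_sup_ubound; exists i.
rewrite lte_fin in r0; exists (2 * 2 `^ r^-1) => [|u v u0 v0].
  by rewrite mulr_gt0// powR_gt0.
have rV0 : 0 <= r^-1 by rewrite invr_ge0 ltW.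
have S0 w : (0 <= \esum_(i in [set: I]) w i `^ r)%E.
  by apply: esum_ge0 => i _; exact: poweR_ge0.
rewrite /lr_norm.
apply: (@le_trans _ _ (((2 `^ r)%:E * (\esum_(i in [set: I]) u i `^ r +
    \esum_(i in [set: I]) v i `^ r)) `^ r^-1)%E).
  apply: le_poweR => //.
  rewrite -esumD; [|by move=> i _; exact: poweR_ge0..].
  apply: le_trans (esumZ_le _ _); [|exact: powR_ge0|]; last first.
    by move=> i; rewrite adde_ge0// poweR_ge0.
  by apply: le_esum => i _; apply: poweRD_le => //; exact: ltW.
rewrite poweRM ?lee_fin ?powR_ge0// ?adde_ge0//=.
rewrite -powRrM mulfV ?gt_eqF// powRr1// EFinM -muleA.
by apply: lee_wpmul2l; [rewrite lee_fin|exact: poweRD_le].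
Qed.

End lr_norm_theory.

Section vnorm_theory.
Context {R : realType} {d : nat}.
Implicit Types z w : 'cV[R[i]]_d.

Lemma vnorm_ge0 z : 0 <= vnorm z. Proof. exact: sqrtr_ge0. Qed.

Lemma vnorm_sqr z : vnorm z ^+ 2 = \sum_i cabs (z i 0) ^+ 2.
Proof. by rewrite sqr_sqrtr// sumr_ge0// => i _; exact: sqr_ge0. Qed.

Lemma vnormZ c z : vnorm (c *: z) = cabs c * vnorm z.
Proof.
apply/eqP; rewrite -(@eqrXn2 _ 2)// ?mulr_ge0 ?vnorm_ge0 ?cabs_ge0//.
rewrite exprMn !vnorm_sqr mulr_sumr; apply/eqP/eq_bigr => i _.
by rewrite mxE cabsM exprMn.
Qed.

Lemma vnorm0 : vnorm (0 : 'cV[R[i]]_d) = 0.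
Proof. by rewrite -(scale0r 0) vnormZ cabs0 mul0r. Qed.

(** The factor 2 comes from bounding |a + b|^2 by 2 |a|^2 + 2 |b|^2 in each
    coordinate. *)
Lemma vnormD z w : vnorm (z + w) <= 2 * (vnorm z + vnorm w).
Proof.
have z0 := vnorm_ge0 z; have w0 := vnorm_ge0 w.
rewrite -(@ler_pXn2r _ 2)// ?nnegrE ?vnorm_ge0 ?mulr_ge0 ?addr_ge0//.
apply: (@le_trans _ _ (2 * (vnorm z ^+ 2 + vnorm w ^+ 2))); last by nra.
rewrite !vnorm_sqr -big_split mulr_sumr; apply: ler_sum => i _ /=.
rewrite mxE !cabs_sqr; case: (z i 0) (w i 0) => [a b] [a' b'] /=.
by have := sqr_ge0 (a - a'); have := sqr_ge0 (b - b'); nra.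
Qed.

End vnorm_theory.

(** * The matrix weighted Bourgain-Morrey quasi-norm *)

Section vmeasurable_theory.
Context {R : realType} {n d : nat}.
Implicit Types f g : Rn R n -> 'cV[R[i]]_d.

Lemma vmeasurable_cst c : vmeasurable (fun _ : Rn R n => c : 'cV[R[i]]_d).
Proof. by move=> i; exact: cmeasurable_cst. Qed.

Lemma vmeasurableDZ (c : R[i]) f g : vmeasurable f -> vmeasurable g ->
  vmeasurable (f + c *: g).
Proof.
move=> mf mg i.
have e x : (f + c *: g) x i 0 = f x i 0 + c * g x i 0 by rewrite /= !mxE.
under eq_fun do rewrite e.
apply: cmeasurableD; first exact: mf.
by apply: cmeasurableM; [exact: cmeasurable_cst|exact: mg].
Qed.

Lemma vmeasurableZ (c : R[i]) f : vmeasurable f -> vmeasurable (c *: f).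
Proof.
by move=> mf; rewrite -[_ *: _]add0r; apply: vmeasurableDZ.
Qed.

Lemma vmeasurableB f g : vmeasurable f -> vmeasurable g -> vmeasurable (f - g).
Proof. by move=> mf mg; rewrite -scaleN1r; exact: vmeasurableDZ. Qed.

Lemma vmeasurable_indic (B : set (Rn R n)) f : measurable B -> vmeasurable f ->
  vmeasurable (fun x => (\1_B x : R)%:C%C *: f x).
Proof.
move=> mB mf i.
have e x : ((\1_B x : R)%:C%C *: f x) i 0 = (\1_B x : R)%:C%C * f x i 0 by rewrite mxE.
under eq_fun do rewrite e.
apply: cmeasurableM; last exact: mf.
by apply: cmeasurable_real; exact: measurable_indic.
Qed.

Lemma measurable_vnorm f : vmeasurable f -> measurable_fun setT (fun x => vnorm (f x)).
Proof.
move=> mf.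
have e x : vnorm (f x) = (\sum_(i < d) cabs (f x i 0) ^+ 2) `^ 2^-1.
  by rewrite powR12_sqrt// sumr_ge0// => i _; exact: sqr_ge0.
under eq_fun do rewrite e.
apply: (@measurableT_comp _ _ _ _ _ _ (@powR R ^~ 2^-1)).
  exact: measurable_powR.
by apply: measurable_sum => i; apply: measurable_normsq; exact: mf.
Qed.

End vmeasurable_theory.

Lemma measurable_dyadic_cube (R : realType) n j k : measurable (@dyadic_cube R n j k).
Proof.
pose A (i : 'I_n) := `[2 ^ (- j) * (tnth k i)%:~R, 2 ^ (- j) * ((tnth k i)%:~R + 1) : R[%classic.
have [+ _] := @lebesgue_box R n A (fun i => measurable_itv _).
suff -> : dyadic_cube j k = [set x : Rn R n | forall i, A i (Rcoord x i)] by [].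
by apply/seteqP; split => x /= h i; have := h i; rewrite /A/= in_itv.
Qed.

(** The integral of a nonnegative function is a supremum over simple functions
    below it, so monotonicity holds without measurability. *)
Lemma ge0_le_integral_nomeas d (T : measurableType d) (R : realType)
    (mu : {measure set T -> \bar R}) (D : set T) (f g : T -> \bar R) :
  (forall x, 0 <= f x)%E -> (forall x, f x <= g x)%E ->
  (\int[mu]_(x in D) f x <= \int[mu]_(x in D) g x)%E.
Proof.
move=> f0 fg.
have g0 x : (0 <= g x)%E by exact: le_trans (fg x).
rewrite integral_mkcond [leRHS]integral_mkcond.
rewrite !ge0_integralTE; [|by move=> x; apply: erestrict_ge0..].
apply: ge_ereal_sup => _ [h hf <-]; apply: ereal_sup_ubound.
exists h => // x; apply: (le_trans (hf x)).
by rewrite /patch; case: ifP.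
Qed.

Section weighted_integral_theory.
Context {R : realType} {n d : nat} (W : Rn R n -> 'M[R[i]]_d) (p : R).
Hypothesis W_ge0 : forall x, nonneg_definite (W x).
Hypothesis mW : mxmeasurable W.
Hypothesis p0 : 0 < p.
Implicit Types f g : Rn R n -> 'cV[R[i]]_d.
Local Notation integrand f := (fun y => (vnorm (mxpow (W y) p^-1 *m f y) `^ p)%:E).

Lemma measurable_integrand f D : vmeasurable f -> measurable_fun D (integrand f).
Proof.
move=> mf; apply: measurable_funTS; apply/measurable_EFinP.
apply: (@measurableT_comp _ _ _ _ _ _ (@powR R ^~ p)).
  exact: measurable_powR.
apply: measurable_vnorm => i.
by apply: (mxmeasurable_mul (mxmeasurable_mxpow W_ge0 mW _)) => a b; rewrite ord1; exact: mf.
Qed.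

Let integrand_ge0 f A y : A y -> (0 <= integrand f y)%E.
Proof. by move=> _; rewrite lee_fin powR_ge0. Qed.

Lemma weighted_integral_ge0 f A : (0 <= weighted_integral W p f A)%E.
Proof. by apply: integral_ge0 => x _; rewrite lee_fin powR_ge0. Qed.

(** Truncating to an arbitrary set, measurable or not, does not increase the
    integral; f is g on that set and 0 elsewhere. *)
Lemma weighted_integral_le f g A : (forall y, f y = g y \/ f y = 0) ->
  (weighted_integral W p f A <= weighted_integral W p g A)%E.
Proof.
move=> fg; apply: ge0_le_integral_nomeas => y; first by rewrite lee_fin powR_ge0.
rewrite lee_fin; case: (fg y) => ->; first exact: lexx.
by rewrite mulmx0 vnorm0 powR0 ?gt_eqF// powR_ge0.
Qed.

Lemma weighted_integralZ c f A : measurable A -> vmeasurable f ->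
  (weighted_integral W p (c *: f) A =
   (cabs c `^ p)%:E * weighted_integral W p f A)%E.
Proof.
move=> mA mf; rewrite /weighted_integral.
have c0 : (0 <= (cabs c `^ p)%:E)%E by rewrite lee_fin powR_ge0.
rewrite -(ge0_integralZl _ mA (measurable_integrand mf) (@integrand_ge0 f A) c0).
apply: eq_integral => y _; rewrite -EFinM; congr EFin.
by rewrite -scalemxAr vnormZ powRM ?cabs_ge0 ?vnorm_ge0.
Qed.

Lemma weighted_integralD f g A : measurable A -> vmeasurable f -> vmeasurable g ->
  (weighted_integral W p (f + g)%R A <=
   ((2 * 2) `^ p)%:E * (weighted_integral W p f A + weighted_integral W p g A))%E.
Proof.
move=> mA mf mg.
have c0 : (0 <= ((2 * 2) `^ p)%:E)%E by rewrite lee_fin powR_ge0.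
have mf' := measurable_integrand (D := A) mf.
have mg' := measurable_integrand (D := A) mg.
have s0 y : A y -> (0 <= integrand f y + integrand g y)%E.
  by move=> Ay; apply: adde_ge0; exact: (integrand_ge0 _ Ay).
rewrite /weighted_integral.
rewrite -(ge0_integralD _ mA (@integrand_ge0 f A) mf' (@integrand_ge0 g A) mg').
rewrite -(ge0_integralZl _ mA (emeasurable_funD mf' mg') s0 c0).
apply: ge0_le_integral_nomeas => y; first by rewrite lee_fin powR_ge0.
rewrite powRM// EFinM -EFinD -muleA.
set a := vnorm (_ *m f y); set b := vnorm (_ *m g y).
apply: (@le_trans _ _ (((2 * (a + b)) `^ p))%:E).
  rewrite lee_fin (ge0_ler_powR (ltW p0))// ?nnegrE ?vnorm_ge0//.
    by rewrite mulr_ge0// addr_ge0// vnorm_ge0.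
  by rewrite /= mulmxDr; exact: vnormD.
rewrite powRM ?addr_ge0 ?vnorm_ge0// EFinM; apply: lee_wpmul2l.
  by rewrite lee_fin powR_ge0.
have := @poweRD_le R p a%:E b%:E (ltW p0); rewrite !lee_fin !vnorm_ge0.
by apply.
Qed.

End weighted_integral_theory.

Section BM_norm_theory.
Context {R : realType} {n d : nat} (W : Rn R n -> 'M[R[i]]_d) (p t : R) (r : \bar R).
Hypothesis W_ge0 : forall x, nonneg_definite (W x).
Hypothesis mW : mxmeasurable W.
Hypothesis p0 : 0 < p.
Hypothesis r0 : (0 < r)%E.
Implicit Types f g : Rn R n -> 'cV[R[i]]_d.
Local Notation BM := (BM_norm W p t r).

Let term f (jk : int * n.-tuple int) : \bar R :=
  let Q := dyadic_cube jk.1 jk.2 in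
  (weight_measure W Q `^ (t^-1 - p^-1) * weighted_integral W p f Q `^ p^-1)%E.

Let term_ge0 f jk : (0 <= term f jk)%E.
Proof. by rewrite mule_ge0// poweR_ge0. Qed.

Lemma BM_norm_le f g : (forall y, f y = g y \/ f y = 0) -> (BM f <= BM g)%E.
Proof.
move=> fg; apply: (le_lr_norm r0 (term_ge0 f)) => jk.
apply: lee_wpmul2l; first exact: poweR_ge0.
apply: le_poweR; first by rewrite invr_ge0 ltW.
  exact: weighted_integral_ge0.
exact: weighted_integral_le.
Qed.

Lemma BM_normZ c f : vmeasurable f -> (BM (c *: f) <= (cabs c)%:E * BM f)%E.
Proof.
move=> mf.
apply: le_trans (lr_normZ r0 (cabs_ge0 c) (term_ge0 f)).
apply: (le_lr_norm r0 (term_ge0 _)) => jk.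
rewrite /term weighted_integralZ//; last exact: measurable_dyadic_cube.
rewrite poweRM ?lee_fin ?powR_ge0 ?weighted_integral_ge0//= -powRrM.
by rewrite mulfV ?gt_eqF// powRr1 ?cabs_ge0// muleCA.
Qed.

Lemma BM_normD : exists2 K : R, 0 < K & forall f g,
  vmeasurable f -> vmeasurable g -> (BM (f + g)%R <= K%:E * (BM f + BM g))%E.
Proof.
have [C C0 lrD] := lr_normD (int * n.-tuple int)%type r0.
have pV0 : 0 <= p^-1 by rewrite invr_ge0 ltW.
pose c := (2 * 2) * 2 `^ p^-1.
have c0 : 0 < c by rewrite mulr_gt0// powR_gt0.
exists (c * C) => [|f g mf mg]; first by rewrite mulr_gt0.
rewrite EFinM -muleA.
apply: (@le_trans _ _ (c%:E * lr_norm r (fun jk => term f jk + term g jk))%E); last first.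
  by apply: lee_wpmul2l; [rewrite lee_fin ltW|exact: lrD].
have tD0 jk : (0 <= term f jk + term g jk)%E by rewrite adde_ge0.
apply: le_trans (lr_normZ r0 (ltW c0) tD0).
apply: (le_lr_norm r0 (term_ge0 _)) => jk.
rewrite /term -ge0_muleDr ?poweR_ge0//.
rewrite muleCA; apply: lee_wpmul2l; first exact: poweR_ge0.
have mQ := @measurable_dyadic_cube R n jk.1 jk.2.
have wi0 h := weighted_integral_ge0 W p h (dyadic_cube jk.1 jk.2).
apply: (le_trans (le_poweR pV0 (wi0 _) (weighted_integralD W_ge0 mW p0 mQ mf mg))).
rewrite poweRM; [|by rewrite lee_fin powR_ge0|exact: adde_ge0].
rewrite /= -powRrM mulfV ?gt_eqF// powRr1// /c [(2 * 2 * 2 `^ _)%:E]EFinM -muleA.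
by apply: lee_wpmul2l; [rewrite lee_fin|exact: poweRD_le].
Qed.

End BM_norm_theory.

(** * Dyadic step functions *)

Section dyadic_grid.
Context {R : realType} {n : nat}.
Implicit Types (x : Rn R n) (j : int).

(** The cube of side 2^(-j) containing x. *)
Definition dyadic_index j x : n.-tuple int :=
  [tuple Num.floor (2 ^ j * Rcoord x i) | i < n].

Lemma dyadic_cubeP j k x : dyadic_cube j k x <-> k = dyadic_index j x.
Proof.
have p2 : 0 < (2 : R) ^ j by rewrite exprz_gt0.
have e (y : R) (z : int) : (2 ^ (- j) * z%:~R <= y < 2 ^ (- j) * (z%:~R + 1)) =
    (z%:~R <= 2 ^ j * y < (z + 1)%:~R).
  by rewrite -invr_expz ler_pdivrMl// ltr_pdivlMl// intrD.
split=> [kx|-> i].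
  apply/eq_from_tnth => i; rewrite tnth_mktuple; apply/esym/floor_def.
  by rewrite -e; exact: kx.
by rewrite e tnth_mktuple floor_itv.
Qed.

(** A bounded set meets finitely many cubes of a given scale. *)
Lemma dyadic_index_ball j (rho : R) : exists s : seq (n.-tuple int),
  uniq s /\ forall x, eucl_ball rho x -> dyadic_index j x \in s.
Proof.
pose N := (Num.truncn (2 ^ j * rho + 1)).+1.
(* The extra 1 accounts for the rounding down in the floor, so that all
   coordinates of the index lie in [-N, N]; g enumerates that range. *)
pose g (o : 'I_(N + N).+1) : int := o%:Z - N%:Z.
pose s := [seq map_tuple g u | u <- enum {: n.-tuple 'I_(N + N).+1}].
exists (undup s); split=> [|x]; first exact: undup_uniq.
rewrite mem_undup /eucl_ball /= => xrho.
have p2 : 0 < (2 : R) ^ j by rewrite exprz_gt0.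
have xi i : `|Rcoord x i| < rho.
  apply: le_lt_trans xrho; rewrite -sqrtr_sqr ler_wsqrtr// (bigD1 i)//=.
  by rewrite lerDl sumr_ge0// => k _; exact: sqr_ge0.
have N_gt : 2 ^ j * rho + 1 < N%:R by exact: truncnS_gt.
pose o i : 'I_(N + N).+1 := inord (absz (tnth (dyadic_index j x) i + N%:Z)).
apply/mapP; exists [tuple o i | i < n]; first by rewrite mem_enum.
apply: eq_from_tnth => i; rewrite [RHS]tnth_map [tnth [tuple o _ | _ < _] _]tnth_mktuple /g /o.
set z := tnth _ i.
have zE : z = Num.floor (2 ^ j * Rcoord x i) by rewrite /z tnth_mktuple.
have /andP[z1 z2] := floor_itv (2 ^ j * Rcoord x i); rewrite -zE in z1 z2.
have : `|2 ^ j * Rcoord x i| < 2 ^ j * rho by rewrite normrM gtr0_norm// ltr_pM2l.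
rewrite ltr_norml => /andP[y1 y2].
have zN : z < N%:Z.
  by rewrite -(ltr_int R) (le_lt_trans z1)//; move: y2 N_gt; rewrite -[N%:~R]/(N%:R : R); lra.
have Nz : - N%:Z < z.
  rewrite -(ltr_int R) rmorphN /= -[N%:~R]/(N%:R : R).
  by move: z2; rewrite intrD => z2; lra.
have zN0 : 0 <= z + N%:Z by lia.
by rewrite inordK; lia.
Qed.

Definition dyadic_mean d j (f : Rn R n -> 'cV[R[i]]_d) k : 'cV[R[i]]_d :=
  ((fine (lebesgue (dyadic_cube j k)))^-1)%:C%C *: vintegral (dyadic_cube j k) f.

(** By [dyadic_cubeP], exactly one term of the sum over all cubes is nonzero. *)
Lemma dyadic_avgE d a (f : Rn R n -> 'cV[R[i]]_d) x :
  dyadic_avg a f x = dyadic_mean (- a) f (dyadic_index (- a) x).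
Proof.
rewrite /dyadic_avg -(@fsbig_widen _ _ _ _ [set dyadic_index (- a) x])//.
  by rewrite fsbig_set1 indicE mem_set ?mul1r//; exact/dyadic_cubeP.
move=> k [_ /= kx]; rewrite indicE memNset ?mul0r ?scale0r//.
by move=> /dyadic_cubeP.
Qed.

Definition dyadic_step d j (s : seq (n.-tuple int)) (c : n.-tuple int -> 'cV[R[i]]_d) :
    Rn R n -> 'cV[R[i]]_d :=
  fun x => if dyadic_index j x \in s then c (dyadic_index j x) else 0.

Definition dyadic_unit d j (a : n.-tuple int * 'I_d) : Rn R n -> 'cV[R[i]]_d :=
  fun x => (\1_(dyadic_cube j a.1) x : R)%:C%C *: delta_mx a.2 0.

Lemma vmeasurable_dyadic_unit d j a : vmeasurable (@dyadic_unit d j a).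
Proof.
apply: vmeasurable_indic; first exact: measurable_dyadic_cube.
exact: vmeasurable_cst.
Qed.

Definition dyadic_units d j (s : seq (n.-tuple int)) : seq (Rn R n -> 'cV[R[i]]_d) :=
  [seq dyadic_unit j a | a <- [seq (k, i) | k <- s, i <- enum 'I_d]].

Lemma spanned_dyadic_step d j s (c : n.-tuple int -> 'cV[R[i]]_d) : uniq s ->
  spanned (dyadic_units d j s) (dyadic_step j s c).
Proof.
move=> us; rewrite (_ : dyadic_step j s c = \sum_(a <- [seq (k, i) | k <- s, i <- enum 'I_d])
    c a.1 a.2 0 *: dyadic_unit j a); first exact: spanned_sum.
apply/funext => x; rewrite fct_sumE big_allpairs.
transitivity (\sum_(k <- s) (\1_(dyadic_cube j k) x : R)%:C%C *: c k); last first.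
  apply: eq_bigr => k _; rewrite big_enum /= [c k in LHS]matrix_sum_delta scaler_sumr.
  apply: eq_bigr => i _; rewrite big_ord1 scalerA mulrC -scalerA.
  by [].
rewrite /dyadic_step; case: ifPn => xs.
  rewrite (bigD1_seq (dyadic_index j x))//= big1 ?addr0 => [|k kx].
    by rewrite indicE mem_set ?scale1r//; exact/dyadic_cubeP.
  rewrite indicE memNset ?scale0r// => /dyadic_cubeP kE.
  by rewrite kE eqxx in kx.
rewrite big1_seq// => k /andP[_ ks]; rewrite indicE memNset ?scale0r//.
by move=> /dyadic_cubeP kE; rewrite -kE ks in xs.
Qed.

Lemma measurable_dyadic_union j (s : seq (n.-tuple int)) :
  measurable [set x : Rn R n | dyadic_index j x \in s].
Proof.
have -> : [set x : Rn R n | dyadic_index j x \in s] = \big[setU/set0]_(k <- s) dyadic_cube j k.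
  rewrite -bigcup_seq; apply/seteqP; split => x /=.
    by move=> xs; exists (dyadic_index j x) => //; exact/dyadic_cubeP.
  by move=> [k ks /dyadic_cubeP kE]; rewrite -kE.
by apply: bigsetU_measurable => k _; exact: measurable_dyadic_cube.
Qed.

Lemma vmeasurable_dyadic_step d j s (c : n.-tuple int -> 'cV[R[i]]_d) :
  uniq s -> vmeasurable (dyadic_step j s c).
Proof.
move=> us; have m0 : @vmeasurable R n d 0 by exact: (vmeasurable_cst (0 : 'cV[R[i]]_d)).
apply: (spanned_sub m0 _ _ (spanned_dyadic_step j c us)) => [b f g|_ /mapP[b _ ->]].
  exact: vmeasurableDZ.
exact: vmeasurable_dyadic_unit.
Qed.

(** Here u is the error on the union U of the cubes in s, where the step function
    agrees with the dyadic average, and v is the error off U, where the step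
    function vanishes and x lies outside the ball. *)
Lemma dyadic_step_error d a s rho (f : Rn R n -> 'cV[R[i]]_d) :
  uniq s -> (forall x, eucl_ball rho x -> dyadic_index (- a) x \in s) ->
  vmeasurable f ->
  exists u v, [/\ vmeasurable u, vmeasurable v,
    f - dyadic_step (- a) s (dyadic_mean (- a) f) = u + v,
    forall x, u x = (f - dyadic_avg a f) x \/ u x = 0 &
    forall x, v x = restrict_off_ball rho f x \/ v x = 0].
Proof.
move=> us hs mf; pose U := [set x : Rn R n | dyadic_index (- a) x \in s].
pose g := dyadic_step (- a) s (dyadic_mean (- a) f).
have mfg : vmeasurable (f - g).
  exact: (vmeasurableB mf (vmeasurable_dyadic_step _ _ us)).
pose u := fun x => (\1_U x : R)%:C%C *: (f - g) x.
have mu : vmeasurable u.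
  by apply: (vmeasurable_indic _ mfg); exact: measurable_dyadic_union.
exists u, (f - g - u); split; [exact: mu|exact: vmeasurableB| |move=> x|move=> x].
- by rewrite [RHS]addrC subrK.
- have -> : u x = (\1_U x : R)%:C%C *: (f x - g x) by [].
  have [xU|xU] := pselect (U x); last first.
    by right; rewrite indicE memNset// scale0r.
  left; rewrite indicE mem_set// scale1r [RHS]/(f x - dyadic_avg a f x).
  by rewrite dyadic_avgE /g /dyadic_step (xU : is_true _).
- have -> : (f - g - u) x = (f x - g x) - (\1_U x : R)%:C%C *: (f x - g x) by [].
  have [xU|xU] := pselect (U x).
    by right; rewrite indicE mem_set// scale1r subrr.
  left; rewrite /restrict_off_ball [\1_U x]indicE memNset// scale0r subr0.
  rewrite indicE mem_set ?scale1r; last by move=> /hs.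
  by rewrite /g /dyadic_step; case: ifPn => [/xU//|_]; exact: subr0.
Qed.

End dyadic_grid.

(** * Total boundedness *)

Lemma BM_norm_sup (R : realType) n d (W : Rn R n -> 'M[R[i]]_d) (p t : R) (r : \bar R)
    (G : set (Rn R n -> 'cV[R[i]]_d)) g :
  G g -> (BM_norm W p t r g <= BM_sup W p t r G)%E.
Proof. by move=> Gg; apply: ereal_sup_ubound; right; exists g. Qed.

Theorem theorem4p1 (R : realType) (n d : nat) (hn : (0 < n)%N) (hd : (0 < d)%N)
    (p t : R) (r : \bar R)
    (hptr : [/\ 1 <= p, p < t, (t%:E < r)%E & (r < +oo)%E] \/
            [/\ 1 <= p, p <= t & r = +oo%E])
    (W : Rn R n -> 'M[R[i]]_d) (hW : matrix_weight W)
    (F : set (Rn R n -> 'cV[R[i]]_d)) (hF : F `<=` BM_space W p t r)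
    (hbounded : (BM_sup W p t r F < +oo)%E)
    (hvanish :
      BM_sup W p t r [set restrict_off_ball rho f | f in F] @[rho --> +oo]
        --> 0%E)
    (hloc : forall f, F f -> vloc_integrable f)
    (hequi :
      BM_sup W p t r [set (f \- dyadic_avg (- m%:Z) f)%R | f in F]
        @[m --> \oo] --> 0%E) :
  BM_totally_bounded W p t r F.
Proof.
have p0 : 0 < p by case: hptr => [[p1 _ _ _]|[p1 _ _]]; exact: lt_le_trans p1.
have r0 : (0 < r)%E.
  case: hptr => [[p1 pt tr _]|[_ _ ->]]; last exact: ltry.
  by apply: lt_trans tr; rewrite lte_fin (lt_trans p0).
case: hW => W_ge0 _ W_loc.
have mW : mxmeasurable W by move=> i j; case: (W_loc i j).
have mF : F `<=` @vmeasurable R n d by move=> f /hF [[]].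
have [K K0 qD] := BM_normD t W_ge0 mW p0 r0.
have m0 : @vmeasurable R n d 0 by exact: (vmeasurable_cst (0 : 'cV[R[i]]_d)).
have [B B0 FB] : exists2 B : R, 0 <= B &
    forall f, F f -> (BM_norm W p t r f <= B%:E)%E.
  have sup0 : (0 <= BM_sup W p t r F)%E by apply: ereal_sup_ubound; left.
  exists (fine (BM_sup W p t r F)) => [|f Ff]; first exact: fine_ge0.
  by rewrite fineK ?ge0_fin_numE//; exact: BM_norm_sup.
move=> e e0.
have [|N [finN NF FN]] := approximation_net K0 m0
    (fun c f g => @vmeasurableDZ R n d c f g) qD
    (fun c f => @BM_normZ R n d W p t r W_ge0 mW p0 r0 c f) mF B0 FB _ e0; last first.
  by exists N; split; [exact: finN|move=> f /NF; exact: hF|exact: FN].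
move=> {}e {}e0; pose D := e / (K + K).
have D0 : 0 < D by rewrite divr_gt0// addr_gt0.
have small : nbhs (0%E : \bar R) [set y | (y < D%:E)%E].
  by apply: open_ereal_lt'; rewrite lte_fin.
(* The neighbourhood of +oo only concerns radii larger than M: use M + 1. *)
have [m _ hm] := hequi _ small; have [M [_ hM]] := hvanish _ small.
have [s [us hs]] := @dyadic_index_ball R n (- - m%:Z) (M + 1).
exists (dyadic_units d (- - m%:Z) s) => [_ /mapP[b _ ->]|f Ff].
  exact: vmeasurable_dyadic_unit.
exists (dyadic_step (- - m%:Z) s (dyadic_mean (- - m%:Z) f)).
  exact: spanned_dyadic_step.
have [u [v [mu mv -> uE vE]]] := dyadic_step_error us hs (mF _ Ff).
have uD : (BM_norm W p t r u <= D%:E)%E.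
  apply: le_trans (BM_norm_le W t p0 r0 uE) _.
  apply/ltW; apply: le_lt_trans (hm m (leqnn m)).
  by apply: BM_norm_sup; exists f.
have vD : (BM_norm W p t r v <= D%:E)%E.
  apply: le_trans (BM_norm_le W t p0 r0 vE) _.
  apply/ltW; apply: le_lt_trans (hM (M + 1) _); last by rewrite ltrDl.
  by apply: BM_norm_sup; exists f.
apply: le_trans (qD _ _ mu mv) _; rewrite (_ : e = K * (D + D)); last first.
  by rewrite /D; field; rewrite gt_eqF// addr_gt0.
rewrite EFinM EFinD; apply: lee_wpmul2l; first by rewrite lee_fin ltW.
exact: (leeD uD vD).
Qed.
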